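(* Let $k$ be a commutative field and let $\mathcal{A}$ be an essentially small additive category which is $k$-trivial. For every integer $d\ge -1$, the subcategory $\mathcal{F}_d(\mathcal{A};k)$ of $\mathcal{F}(\mathcal{A};k)$ is bilocalizing.
   Context: $\mathcal{F}(\mathcal{A};k)$ is the abelian category of all (not necessarily additive) functors from $\mathcal{A}$ to $k$-vector spaces, with pointwise exactness; it is a Grothendieck category. $\mathcal{A}$ is $k$-trivial if for all objects $x,y$ the abelian group $\mathcal{A}(x,y)$ is finite of order invertible in $k$. For $F\in\mathcal{F}(\mathcal{A};k)$ and $x\in\mathrm{Ob}\,\mathcal{A}$: $\tau_x(F)(a)=F(x\oplus a)$. The group $\mathcal{A}(x,a)$ acts on $F(x\oplus a)$ through $u\mapsto F\begin{pmatrix}\mathrm{Id}_x&0\\ u&\mathrm{Id}_a\end{pmatrix}$, and $\bar\tau_x(F)(a):=F(x\oplus a)_{\mathcal{A}(x,a)}$ (coinvariants), a quotient functor of $\tau_x(F)$. The canonical inclusions $a\to x\oplus a$ induce a natural morphism $F\to\bar\tau_x(F)$, whose cokernel is $\bar\delta_x(F)$. For $d\ge -1$, $\mathcal{F}_d(\mathcal{A};k)$ is the full subcategory of functors $F$ with $\bar\delta_{a_0}\cdots\bar\delta_{a_d}\tau_x(F)=0$ for all objects $a_0,\dots,a_d,x$. A full subcategory $\mathcal{E}'$ of an abelian category $\mathcal{E}$ is thick if it is stable under subobjects, quotients and extensions. A thick subcategory is localizing (resp. colocalizing) if the canonical functor $\mathcal{E}\to\mathcal{E}/\mathcal{E}'$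 has a right (resp. left) adjoint, and bilocalizing if it is both; in a Grothendieck category, a thick subcategory is localizing iff it is stable under arbitrary coproducts, and bilocalizing iff it is stable under arbitrary products. *)

(* Defs.v *)
From HB Require Import structures.
From mathcomp Require Import all_boot all_order all_algebra.
From mathcomp Require Import boolp classical_sets functions cardinality.

Set Implicit Arguments.
Unset Strict Implicit.
Unset Printing Implicit Defensive.

Import GRing.Theory.
Local Open Scope quotient_scope.
Local Open Scope ring_scope.

Record category := Category {
  obj :> Type;
  hom : obj -> obj -> Type;
  idm : forall x, hom x x;
  comp : forall x y z, hom y z -> hom x y -> hom x z;
  compmA : forall x y z t (h : hom z t) (g : hom y z) (f : hom x y),
    comp h (comp g f) = comp (comp h g) f;
  comp1m : forall x y (f : hom x y), comp (idm y) f = f;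
  compm1 : forall x y (f : hom x y), comp f (idm x) = f }.

Arguments idm {c} x.
Arguments comp {c x y z}.

Declare Scope cat_scope.
Delimit Scope cat_scope with cat.
Local Open Scope cat_scope.
Notation "g \oc f" := (comp g f) (at level 40, left associativity) : cat_scope.

Definition is_iso (C : category) (x y : C) (f : hom x y) : Prop :=
  exists g : hom y x, g \oc f = idm x /\ f \oc g = idm y.

Definition isomorphic (C : category) (x y : C) : Prop :=
  exists f : hom x y, is_iso f.

Definition monic (C : category) (x y : C) (f : hom x y) : Prop :=
  forall z (g h : hom z x), f \oc g = f \oc h -> g = h.

Definition epic (C : category) (x y : C) (f : hom x y) : Prop :=
  forall z (g h : hom y z), g \oc f = h \oc f -> g = h.

Definition is_zero_object (C : category) (z : C) : Prop :=
  (forall x, exists! f : hom x z, True) /\ (forall x, exists! f : hom z x, True).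

(** Zero morphisms are those that factor through a zero object; in an abelian
    category this is the usual notion. *)
Definition is_zero_mor (C : category) (x y : C) (f : hom x y) : Prop :=
  exists z, is_zero_object z /\
    exists (g : hom x z) (h : hom z y), f = h \oc g.

Definition is_kernel (C : category) (n x y : C) (i : hom n x) (f : hom x y) :
    Prop :=
  is_zero_mor (f \oc i) /\
  forall t (g : hom t x), is_zero_mor (f \oc g) -> exists! h, i \oc h = g.

Definition is_cokernel (C : category) (x y c : C) (p : hom y c) (f : hom x y) :
    Prop :=
  is_zero_mor (p \oc f) /\
  forall t (g : hom y t), is_zero_mor (g \oc f) -> exists! h, h \oc p = g.

Definition short_exact (C : category) (x y z : C) (i : hom x y) (p : hom y z) :
    Prop :=
  is_kernel i p /\ is_cokernel p i.

Record functor (C D : category) := Functor {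
  fobj :> C -> D;
  fmap : forall x y, hom x y -> hom (fobj x) (fobj y);
  fmap1 : forall x, fmap (idm x) = idm (fobj x);
  fmapM : forall x y z (g : hom y z) (f : hom x y),
    fmap (g \oc f) = fmap g \oc fmap f }.

Arguments fmap {C D} _ {x y} _.

Definition id_functor (C : category) : functor C C.
Proof. by exists (fun x => x) (fun x y f => f). Defined.

Definition comp_functor (C D E : category) (G : functor D E) (F : functor C D) :
  functor C E.
Proof.
exists (fun x => G (F x)) (fun x y f => fmap G (fmap F f)).
- by move=> x; rewrite !fmap1.
- by move=> x y z g f; rewrite !fmapM.
Defined.

Record nat_trans (C D : category) (F G : functor C D) := NatTrans {
  nt_app :> forall x, hom (F x) (G x);
  nt_nat : forall x y (f : hom x y),
    nt_app y \oc fmap F f = fmap G f \oc nt_app x }.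

Lemma nat_transP (C D : category) (F G : functor C D) (s t : nat_trans F G) :
  (forall x, s x = t x) -> s = t.
Proof.
case: s t => [s hs] [t ht] /= st.
have {st} e : s = t by apply: functional_extensionality_dep.
by case: t / e ht => ht; congr NatTrans; apply: Prop_irrelevance.
Qed.

Definition nt_id (C D : category) (F : functor C D) : nat_trans F F.
Proof. by exists (fun x => idm (F x)) => x y f; rewrite comp1m compm1. Defined.

Definition nt_comp (C D : category) (F G H : functor C D)
  (t : nat_trans G H) (s : nat_trans F G) : nat_trans F H.
Proof.
by exists (fun x => t x \oc s x) => x y f; rewrite -compmA nt_nat !compmA nt_nat.
Defined.

Definition functor_cat (C D : category) : category.
Proof.
exists (functor C D) (@nat_trans C D) (@nt_id C D) (@nt_comp C D).
- by move=> x y z t h g f; apply: nat_transP => a /=; rewrite compmA.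
- by move=> x y f; apply: nat_transP => a /=; rewrite comp1m.
- by move=> x y f; apply: nat_transP => a /=; rewrite compm1.
Defined.

Record adjunction (C D : category) (L : functor C D) (R : functor D C) :=
  Adjunction {
  adj_unit : nat_trans (id_functor C) (comp_functor R L);
  adj_counit : nat_trans (comp_functor L R) (id_functor D);
  adj_triL : forall x, adj_counit (L x) \oc fmap L (adj_unit x) = idm (L x);
  adj_triR : forall y, fmap R (adj_counit y) \oc adj_unit (R y) = idm (R y) }.

Definition has_right_adjoint (C D : category) (F : functor C D) : Prop :=
  exists G : functor D C, inhabited (adjunction F G).

Definition has_left_adjoint (C D : category) (F : functor C D) : Prop :=
  exists G : functor D C, inhabited (adjunction G F).

Definition eqclass (T : Type) (R : T -> T -> Prop) : Type :=
  {P : T -> Prop | exists x, P = R x}.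

Definition class_of (T : Type) (R : T -> T -> Prop) (x : T) : eqclass R :=
  exist _ (R x) (ex_intro _ x erefl).

Definition class_repr (T : Type) (R : T -> T -> Prop) (c : eqclass R) : T :=
  projT1 (cid (proj2_sig c)).

Lemma class_reprK (T : Type) (R : T -> T -> Prop) (c : eqclass R) :
  class_of R (class_repr c) = c.
Proof.
rewrite /class_repr; case: c => P hP /=; case: cid => x /= e.
by apply: eq_exist.
Qed.

(** Formal composites of morphisms of [C] and of formal inverses of morphisms
    in [W], and the smallest congruence turning them into a category in which
    [C] maps functorially and [W] becomes invertible. *)
Inductive word (C : category) (W : forall x y : C, hom x y -> Prop) :
    C -> C -> Type :=
  | w_mor x y (f : hom x y) : word W x y
  | w_inv x y (f : hom x y) (Wf : W x y f) : word W y x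
  | w_comp x y z (q : word W y z) (p : word W x y) : word W x z.

Inductive word_eq (C : category) (W : forall x y : C, hom x y -> Prop) :
    forall x y : C, word W x y -> word W x y -> Prop :=
  | we_refl x y (p : word W x y) : word_eq p p
  | we_sym x y (p q : word W x y) : word_eq p q -> word_eq q p
  | we_trans x y (p q r : word W x y) :
      word_eq p q -> word_eq q r -> word_eq p r
  | we_comp x y z (q q' : word W y z) (p p' : word W x y) :
      word_eq q q' -> word_eq p p' -> word_eq (w_comp q p) (w_comp q' p')
  | we_compA x y z t (r : word W z t) (q : word W y z) (p : word W x y) :
      word_eq (w_comp r (w_comp q p)) (w_comp (w_comp r q) p)
  | we_comp1w x y (p : word W x y) : word_eq (w_comp (w_mor W (idm y)) p) p
  | we_compw1 x y (p : word W x y) : word_eq (w_comp p (w_mor W (idm x))) p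
  | we_mor x y z (g : hom y z) (f : hom x y) :
      word_eq (w_mor W (g \oc f)) (w_comp (w_mor W g) (w_mor W f))
  | we_invK x y (f : hom x y) (Wf : W x y f) :
      word_eq (w_comp (w_inv Wf) (w_mor W f)) (w_mor W (idm x))
  | we_Kinv x y (f : hom x y) (Wf : W x y f) :
      word_eq (w_comp (w_mor W f) (w_inv Wf)) (w_mor W (idm y)).

Definition loc_hom (C : category) (W : forall x y : C, hom x y -> Prop)
    (x y : C) : Type :=
  eqclass (@word_eq C W x y).

Definition loc_class (C : category) (W : forall x y : C, hom x y -> Prop)
    (x y : C) (p : word W x y) : loc_hom W x y :=
  class_of (@word_eq C W x y) p.

Lemma loc_classP (C : category) (W : forall x y : C, hom x y -> Prop)
    (x y : C) (p q : word W x y) :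
  loc_class p = loc_class q <-> word_eq p q.
Proof.
split=> [[e]|pq].
  by have : word_eq q q := we_refl q; rewrite -[word_eq q]e.
apply: eq_exist; apply/predeqP => r; split; last exact: we_trans.
exact: (we_trans (we_sym pq)).
Qed.

Definition loc_comp (C : category) (W : forall x y : C, hom x y -> Prop)
    (x y z : C) (g : loc_hom W y z) (f : loc_hom W x y) : loc_hom W x z :=
  loc_class (w_comp (class_repr g) (class_repr f)).

Lemma loc_compE (C : category) (W : forall x y : C, hom x y -> Prop)
    (x y z : C) (q : word W y z) (p : word W x y) :
  loc_comp (loc_class q) (loc_class p) = loc_class (w_comp q p).
Proof.
by apply/loc_classP; apply: we_comp; apply/loc_classP; apply: class_reprK.
Qed.

Lemma loc_classK (C : category) (W : forall x y : C, hom x y -> Prop)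
    (x y : C) (c : loc_hom W x y) : loc_class (class_repr c) = c.
Proof. exact: class_reprK. Qed.

Definition localization (C : category) (W : forall x y : C, hom x y -> Prop) :
  category.
Proof.
exists C (@loc_hom C W) (fun x => loc_class (w_mor W (idm x))) (@loc_comp C W).
- move=> x y z t h g f.
  rewrite -(loc_classK h) -(loc_classK g) -(loc_classK f) !loc_compE.
  by apply/loc_classP; apply: we_compA.
- move=> x y f; rewrite -(loc_classK f) loc_compE.
  by apply/loc_classP; apply: we_comp1w.
- move=> x y f; rewrite -(loc_classK f) loc_compE.
  by apply/loc_classP; apply: we_compw1.
Defined.

Definition loc_functor (C : category) (W : forall x y : C, hom x y -> Prop) :
  functor C (localization W).
Proof.
exists (fun x : C => x : localization W) (fun x y f => loc_class (w_mor W f)).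
- by [].
- move=> x y z g f; rewrite /= loc_compE; apply/loc_classP; exact: we_mor.
Defined.

(** A full subcategory is given by a predicate on objects. *)

Definition thick (E : category) (P : E -> Prop) : Prop :=
  [/\ forall (x y : E) (i : hom x y), monic i -> P y -> P x,
      forall (x y : E) (p : hom x y), epic p -> P x -> P y
    & forall (x y z : E) (i : hom x y) (p : hom y z),
        short_exact i p -> P x -> P z -> P y].

Definition iso_mod (E : category) (P : E -> Prop) (x y : E) (f : hom x y) :
    Prop :=
  (exists (n : E) (i : hom n x), is_kernel i f /\ P n) /\
  (exists (c : E) (p : hom y c), is_cokernel p f /\ P c).

(** The Serre quotient is the localization at the morphisms whose kernel and
    cokernel belong to the subcategory. *)
Definition serre_quotient (E : category) (P : E -> Prop) : category :=
  localization (@iso_mod E P).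

Definition quotient_functor (E : category) (P : E -> Prop) :
    functor E (serre_quotient P) :=
  loc_functor (@iso_mod E P).

Definition localizing (E : category) (P : E -> Prop) : Prop :=
  thick P /\ has_right_adjoint (quotient_functor P).

Definition colocalizing (E : category) (P : E -> Prop) : Prop :=
  thick P /\ has_left_adjoint (quotient_functor P).

Definition bilocalizing (E : category) (P : E -> Prop) : Prop :=
  localizing P /\ colocalizing P.

Record additive_category := AdditiveCategory {
  aobj : Type;
  ahom : aobj -> aobj -> zmodType;
  aid : forall x, ahom x x;
  acomp : forall x y z, ahom y z -> ahom x y -> ahom x z;
  acompA : forall x y z t (h : ahom z t) (g : ahom y z) (f : ahom x y),
    acomp h (acomp g f) = acomp (acomp h g) f;
  acomp1m : forall x y (f : ahom x y), acomp (aid y) f = f;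
  acompm1 : forall x y (f : ahom x y), acomp f (aid x) = f;
  acompDl : forall x y z (g g' : ahom y z) (f : ahom x y),
    acomp (g + g') f = acomp g f + acomp g' f;
  acompDr : forall x y z (g : ahom y z) (f f' : ahom x y),
    acomp g (f + f') = acomp g f + acomp g f';
  azero : aobj;
  aid_azero : aid azero = 0;
  asum : aobj -> aobj -> aobj;
  ain1 : forall x y, ahom x (asum x y);
  ain2 : forall x y, ahom y (asum x y);
  apr1 : forall x y, ahom (asum x y) x;
  apr2 : forall x y, ahom (asum x y) y;
  apr1_in1 : forall x y, acomp (apr1 x y) (ain1 x y) = aid x;
  apr2_in2 : forall x y, acomp (apr2 x y) (ain2 x y) = aid y;
  apr1_in2 : forall x y, acomp (apr1 x y) (ain2 x y) = 0;
  apr2_in1 : forall x y, acomp (apr2 x y) (ain1 x y) = 0;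
  asum_id : forall x y,
    acomp (ain1 x y) (apr1 x y) + acomp (ain2 x y) (apr2 x y) = aid (asum x y) }.

Arguments aid {a} x.
Arguments acomp {a x y z}.
Arguments ain1 {a} x y.
Arguments ain2 {a} x y.
Arguments apr1 {a} x y.
Arguments apr2 {a} x y.

Definition acat (A : additive_category) : category :=
  Category (@acompA A) (@acomp1m A) (@acompm1 A).
Coercion acat : additive_category >-> category.

Notation "x (+) y" := (asum x y) (at level 50, left associativity) : cat_scope.

Lemma acomp0l (A : additive_category) (x y z : aobj A) (f : ahom x y) :
  acomp (0 : ahom y z) f = 0.
Proof. by apply: (addrI (acomp 0 f)); rewrite -acompDl !addr0. Qed.

Lemma acomp0r (A : additive_category) (x y z : aobj A) (g : ahom y z) :
  acomp g (0 : ahom x y) = 0.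
Proof. by apply: (addrI (acomp g 0)); rewrite -acompDr !addr0. Qed.

(** The morphism [x (+) a -> y (+) b] with matrix [[f, g], [u, h]]. *)
Definition mx22 (A : additive_category) (x a y b : aobj A)
    (f : ahom x y) (g : ahom a y) (u : ahom x b) (h : ahom a b) :
    ahom (x (+) a) (y (+) b) :=
  acomp (ain1 y b) (acomp f (apr1 x a) + acomp g (apr2 x a)) +
  acomp (ain2 y b) (acomp u (apr1 x a) + acomp h (apr2 x a)).

Lemma mx22_pr1 (A : additive_category) (x a y b : aobj A)
    (f : ahom x y) (g : ahom a y) (u : ahom x b) (h : ahom a b) :
  acomp (apr1 y b) (mx22 f g u h) = acomp f (apr1 x a) + acomp g (apr2 x a).
Proof.
by rewrite /mx22 acompDr !acompA apr1_in1 apr1_in2 acomp1m acomp0l addr0.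
Qed.

Lemma mx22_pr2 (A : additive_category) (x a y b : aobj A)
    (f : ahom x y) (g : ahom a y) (u : ahom x b) (h : ahom a b) :
  acomp (apr2 y b) (mx22 f g u h) = acomp u (apr1 x a) + acomp h (apr2 x a).
Proof.
by rewrite /mx22 acompDr !acompA apr2_in1 apr2_in2 acomp1m acomp0l add0r.
Qed.

Lemma mx22_in2 (A : additive_category) (x a y b : aobj A)
    (f : ahom x y) (g : ahom a y) (u : ahom x b) (h : ahom a b) :
  acomp (mx22 f g u h) (ain2 x a) =
  acomp (ain1 y b) g + acomp (ain2 y b) h.
Proof.
rewrite /mx22 acompDl -!acompA !acompDl -!acompA apr1_in2 apr2_in2.
by rewrite !acomp0r !acompm1 !add0r.
Qed.

Lemma mx22M (A : additive_category) (x a y b z c : aobj A)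
    (f : ahom x y) (g : ahom a y) (u : ahom x b) (h : ahom a b)
    (f' : ahom y z) (g' : ahom b z) (u' : ahom y c) (h' : ahom b c) :
  acomp (mx22 f' g' u' h') (mx22 f g u h) =
  mx22 (acomp f' f + acomp g' u) (acomp f' g + acomp g' h)
       (acomp u' f + acomp h' u) (acomp u' g + acomp h' h).
Proof.
rewrite {1}/mx22 acompDl -!acompA !acompDl -!acompA mx22_pr1 mx22_pr2.
rewrite [RHS]/mx22 !acompDl !acompDr !acompA.
by congr (_ + _); rewrite addrACA.
Qed.

Lemma mx22_1 (A : additive_category) (x a : aobj A) :
  mx22 (aid x) 0 0 (aid a) = aid (x (+) a).
Proof. by rewrite /mx22 !acomp1m !acomp0l addr0 add0r asum_id. Qed.

(** "Small" refers to the universe of the underlying sets of vector spaces: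
    [small_function_space] constrains [small_set] to lie in it. For [k]-trivial
    categories the sets of morphisms are finite, so that smallness only has to
    be imposed on the isomorphism classes of objects. *)
Definition small_set := Type.

Definition small_function_space (k : fieldType) (I : small_set) : lmodType k :=
  (I -> k^o : Type).

Definition essentially_small (C : category) : Prop :=
  exists (I : small_set) (f : I -> C), forall x, exists i, isomorphic x (f i).

Definition k_trivial (k : fieldType) (A : additive_category) : Prop :=
  forall x y : A, exists2 n : nat,
    ([set: ahom x y] #= `I_n)%card & (n%:R : k) \is a GRing.unit.

Lemma linearP_ext (k : fieldType) (U V : lmodType k) (f g : {linear U -> V}) :
  f =1 g -> f = g.
Proof.
case: f g => [f [[hf] [hf']]] [g [[hg] [hg']]] /= fg.
have {fg} e : f = g by apply/funext.
case: g / e hg hg' => hg hg'.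
by rewrite (Prop_irrelevance hf hg) (Prop_irrelevance hf' hg').
Qed.

Definition vect_cat (k : fieldType) : category.
Proof.
exists (lmodType k) (fun U V : lmodType k => {linear U -> V})
  (fun U : lmodType k => idfun : {linear U -> U})
  (fun (U V W : lmodType k) (g : {linear V -> W}) (f : {linear U -> V}) =>
     g \o f : {linear U -> W}).
- by move=> *; apply: linearP_ext.
- by move=> *; apply: linearP_ext.
- by move=> *; apply: linearP_ext.
Defined.

Definition lspan (k : fieldType) (V : lmodType k) (G : V -> Prop) : {pred V} :=
  fun v => `[< forall S : submodClosed V,
                 (forall g, G g -> g \in S) -> v \in S >].

Lemma lspan_gen (k : fieldType) (V : lmodType k) (G : V -> Prop) (v : V) :
  G v -> v \in lspan G.
Proof. by move=> Gv; apply/asboolP => S; apply. Qed.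

Lemma lspan_min (k : fieldType) (V : lmodType k) (G : V -> Prop)
  (S : submodClosed V) :
  (forall g, G g -> g \in S) -> forall v, v \in lspan G -> v \in S.
Proof. by move=> GS v /asboolP; apply. Qed.

Fact lspan_submod_closed (k : fieldType) (V : lmodType k) (G : V -> Prop) :
  submod_closed (lspan G).
Proof.
split; first by apply/asboolP => S _; apply: rpred0.
move=> a u v /asboolP uG /asboolP vG; apply/asboolP => S GS.
by apply: rpredD; [apply: rpredZ; apply: uG | apply: vG].
Qed.

HB.instance Definition _ (k : fieldType) (V : lmodType k) (G : V -> Prop) :=
  GRing.isSubmodClosed.Build k V (lspan G) (lspan_submod_closed G).

Lemma lspan_sub (k : fieldType) (U V : lmodType k) (f : {linear U -> V})
  (G : U -> Prop) (H : V -> Prop) :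
  (forall g, G g -> f g \in lspan H) ->
  forall v, v \in lspan G -> f v \in lspan H.
Proof.
move=> GH v /asboolP vG.
pose P : {pred U} := fun u => f u \in lspan H.
have PE u : (u \in P) = (f u \in lspan H) by [].
have Pc : submod_closed P.
  split; first by rewrite PE linear0 rpred0.
  move=> a u w; rewrite !PE linearP => Pu Pw.
  by apply: rpredD => //; apply: rpredZ.
pose S : submodClosed U := HB.pack P (GRing.isSubmodClosed.Build k U P Pc).
exact: (vG S).
Qed.

Definition limage (k : fieldType) (U V : lmodType k) (f : {linear U -> V}) :
    {pred V} :=
  fun v => `[< exists u, f u = v >].

Fact limage_submod_closed (k : fieldType) (U V : lmodType k)
  (f : {linear U -> V}) : submod_closed (limage f).
Proof.
split; first by apply/asboolP; exists 0; rewrite linear0.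
move=> a _ _ /asboolP[u <-] /asboolP[v <-]; apply/asboolP.
by exists (a *: u + v); rewrite linearP.
Qed.

HB.instance Definition _ (k : fieldType) (U V : lmodType k)
    (f : {linear U -> V}) :=
  GRing.isSubmodClosed.Build k V (limage f) (limage_submod_closed f).

Section QuotientSpace.
Variables (k : fieldType) (V : lmodType k) (S : submodClosed V).

Definition sub_zmod : {pred V} := S.
HB.instance Definition _ :=
  GRing.isZmodClosed.Build V sub_zmod (GRing.submod_closedB (GRing.submodClosedP S)).

Definition quot_space := {ideal_quot sub_zmod}.
HB.instance Definition _ := GRing.Zmodule.on quot_space.

Definition quot_pi (v : V) : quot_space := \pi_{ideal_quot sub_zmod} v.

Lemma quot_piP (u v : V) : quot_pi u = quot_pi v <-> u - v \in S.
Proof.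
rewrite /quot_pi -[_ \in S]/(u - v \in sub_zmod).
by rewrite Quotient.idealrBE; split=> [->|/eqP].
Qed.

Lemma quot_piK (q : quot_space) : quot_pi (repr q) = q.
Proof. exact: reprK. Qed.

Fact quot_piD (u v : V) : quot_pi (u + v) = quot_pi u + quot_pi v.
Proof. exact: (raddfD (\pi_{ideal_quot sub_zmod})). Qed.

Definition quot_scale (a : k) (q : quot_space) : quot_space :=
  quot_pi (a *: repr q).

Fact quot_scaleE a v : quot_scale a (quot_pi v) = quot_pi (a *: v).
Proof.
by apply/quot_piP; rewrite -scalerBr rpredZ //; apply/quot_piP/quot_piK.
Qed.

Fact quot_scaleA a b q : quot_scale a (quot_scale b q) = quot_scale (a * b) q.
Proof. by rewrite -(quot_piK q) !quot_scaleE scalerA. Qed.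

Fact quot_scale1 : left_id 1 quot_scale.
Proof. by move=> q; rewrite -(quot_piK q) quot_scaleE scale1r. Qed.

Fact quot_scaleDr : right_distributive quot_scale +%R.
Proof.
move=> a p q; rewrite -(quot_piK p) -(quot_piK q).
by rewrite -quot_piD !quot_scaleE scalerDr quot_piD.
Qed.

Fact quot_scaleDl q : {morph quot_scale^~ q : a b / a + b}.
Proof.
by move=> a b; rewrite -(quot_piK q) !quot_scaleE scalerDl quot_piD.
Qed.

HB.instance Definition _ := GRing.Zmodule_isLmodule.Build k quot_space
  quot_scaleA quot_scale1 quot_scaleDr quot_scaleDl.

Fact quot_pi_linear : linear quot_pi.
Proof. by move=> a u v; rewrite quot_piD -quot_scaleE. Qed.

HB.instance Definition _ :=
  GRing.isLinear.Build k V quot_space *:%R quot_pi quot_pi_linear.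

End QuotientSpace.

Section QuotientMap.
Variables (k : fieldType) (U V : lmodType k).
Variables (S : submodClosed U) (T : submodClosed V) (f : {linear U -> V}).
Hypothesis fST : forall u, u \in S -> f u \in T.

Definition quot_map (q : quot_space S) : quot_space T := quot_pi T (f (repr q)).

Lemma quot_mapE u : quot_map (quot_pi S u) = quot_pi T (f u).
Proof. by apply/quot_piP; rewrite -linearB fST //; apply/quot_piP/quot_piK. Qed.

Fact quot_map_linear : linear quot_map.
Proof.
move=> a p q; rewrite -(quot_piK p) -(quot_piK q) -linearP.
by rewrite !quot_mapE !linearP.
Qed.

Definition quot_lin : {linear quot_space S -> quot_space T} :=
  HB.pack quot_map (GRing.isLinear.Build _ _ _ _ _ quot_map_linear).

End QuotientMap.

Definition fun_vect (C : category) (k : fieldType) : category :=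
  functor_cat C (vect_cat k).

Section VectFunctor.
Variables (C : category) (k : fieldType).

(** [F x], [fmap F f] and [t x], retyped so that they are seen as a vector space
    and as linear maps without unfolding [vect_cat]. *)
Definition fsp (F : functor C (vect_cat k)) (x : C) : lmodType k := F x.

Definition flin (F : functor C (vect_cat k)) (x y : C) (f : hom x y) :
  {linear fsp F x -> fsp F y} := fmap F f.

Definition nlin (F G : functor C (vect_cat k)) (t : nat_trans F G) (x : C) :
  {linear fsp F x -> fsp G x} := t x.

Lemma flin1 (F : functor C (vect_cat k)) x (v : fsp F x) : flin F (idm x) v = v.
Proof. by rewrite /flin fmap1. Qed.

Lemma flinM (F : functor C (vect_cat k)) x y z (g : hom y z) (f : hom x y)
  (v : fsp F x) : flin F (g \oc f) v = flin F g (flin F f v).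
Proof. by rewrite /flin fmapM. Qed.

Lemma nlin_nat (F G : functor C (vect_cat k)) (t : nat_trans F G)
  x y (f : hom x y) (v : fsp F x) :
  nlin t y (flin F f v) = flin G f (nlin t x v).
Proof. exact: (congr1 (fun h : {linear _ -> _} => h v) (nt_nat t f)). Qed.

End VectFunctor.

Record subfunctor (C : category) (k : fieldType) (F : functor C (vect_cat k)) :=
  Subfunctor {
  sub_at : forall x, submodClosed (fsp F x);
  sub_stable : forall x y (f : hom x y) (v : fsp F x),
    v \in sub_at x -> flin F f v \in sub_at y }.

Definition quot_functor (C : category) (k : fieldType)
  (F : functor C (vect_cat k)) (S : subfunctor F) : functor C (vect_cat k).
Proof.
exists (fun x => quot_space (sub_at S x) : lmodType k)
  (fun x y f => quot_lin (@sub_stable _ _ _ S x y f)).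
- move=> x; apply: linearP_ext => q; rewrite -(quot_piK q).
  by rewrite /= quot_mapE ?flin1 //; apply: sub_stable.
- move=> x y z g f; apply: linearP_ext => q; rewrite -(quot_piK q).
  by rewrite /= !quot_mapE ?flinM //; apply: sub_stable.
Defined.

Definition quot_proj (C : category) (k : fieldType)
  (F : functor C (vect_cat k)) (S : subfunctor F) :
  nat_trans F (quot_functor S).
Proof.
exists (fun x => quot_pi (sub_at S x) : {linear fsp F x -> _}).
move=> x y f; apply: linearP_ext => v /=.
by rewrite quot_mapE //; apply: sub_stable.
Defined.

Definition image_functor (C : category) (k : fieldType)
  (F G : functor C (vect_cat k)) (t : nat_trans F G) : subfunctor G.
Proof.
exists (fun x => limage (nlin t x) : submodClosed (fsp G x)).
move=> x y f _ /asboolP[u <-]; apply/asboolP; exists (flin F f u).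
exact: nlin_nat.
Defined.

Definition coker_functor (C : category) (k : fieldType)
    (F G : functor C (vect_cat k)) (t : nat_trans F G) :
    functor C (vect_cat k) :=
  quot_functor (image_functor t).

Definition sum_functor (A : additive_category) (x : A) : functor A A.
Proof.
exists (fun a : A => x (+) a : A)
  (fun (a b : A) (f : ahom a b) => mx22 (aid x) 0 0 f).
- by move=> a; apply: mx22_1.
- move=> a b c g f /=; rewrite mx22M !acomp0l !acomp0r !acomp1m.
  by rewrite !addr0 !add0r.
Defined.

Definition tau (A : additive_category) (k : fieldType) (x : A)
    (F : functor A (vect_cat k)) : functor A (vect_cat k) :=
  comp_functor F (sum_functor x).

Definition shear (A : additive_category) (x a : A) (u : ahom x a) :
    @hom A (x (+) a) (x (+) a) :=
  mx22 (aid x) 0 u (aid a).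

(** The elements [u v - v], for the action of [ahom x a] on [F (x (+) a)]. *)
Definition coinv_gen (A : additive_category) (k : fieldType) (x : A)
    (F : functor A (vect_cat k)) (a : A) (w : fsp (tau x F) a) : Prop :=
  exists (u : ahom x a) (v : fsp F (x (+) a)), w = flin F (shear u) v - v.

Definition coinv_sub (A : additive_category) (k : fieldType) (x : A)
  (F : functor A (vect_cat k)) : subfunctor (tau x F).
Proof.
exists (fun a => lspan (@coinv_gen A k x F a) : submodClosed (fsp (tau x F) a)).
move=> a b f; apply: lspan_sub => _ [u [v ->]]; apply: lspan_gen.
exists (acomp f u), (flin (tau x F) f v); rewrite linearB; congr (_ - _).
rewrite /flin /= -[LHS](flinM (F := F)) -[RHS](flinM (F := F)); congr (flin F _ v).
rewrite /= /shear !mx22M !acomp0l !acomp0r !acomp1m !acompm1.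
by rewrite !addr0 !add0r.
Defined.

Definition bar_tau (A : additive_category) (k : fieldType) (x : A)
    (F : functor A (vect_cat k)) : functor A (vect_cat k) :=
  quot_functor (coinv_sub x F).

Definition incl_tau (A : additive_category) (k : fieldType) (x : A)
  (F : functor A (vect_cat k)) : nat_trans F (tau x F).
Proof.
exists (fun a => fmap F (ain2 x a : @hom A a (x (+) a))).
move=> a b f; apply: etrans (esym (fmapM F _ _)) (etrans _ (fmapM F _ _)).
by congr (fmap F _); rewrite /= mx22_in2 acomp0r add0r.
Defined.

Definition incl_bar_tau (A : additive_category) (k : fieldType) (x : A)
    (F : functor A (vect_cat k)) : nat_trans F (bar_tau x F) :=
  nt_comp (quot_proj (coinv_sub x F)) (incl_tau x F).

Definition bar_delta (A : additive_category) (k : fieldType) (x : A)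
    (F : functor A (vect_cat k)) : functor A (vect_cat k) :=
  coker_functor (incl_bar_tau x F).

(** For [s = [:: a_0; ..; a_d]], the [foldr] below is
    [bar_delta a_0 (.. (bar_delta a_d (tau x F)))]; it is [tau x F] if [d = -1]. *)
Definition Fd (A : additive_category) (k : fieldType) (d : int)
    (F : fun_vect A k) : Prop :=
  forall (s : seq A) (x : A), (size s)%:Z = d + 1 ->
    is_zero_object (foldr (@bar_delta A k) (tau x F) s : fun_vect A k).

Arguments Fd A k d F : clear implicits.

(* Main.v *)
From HB Require Import structures.
From mathcomp Require Import all_boot all_order all_algebra.
From mathcomp Require Import boolp classical_sets functions cardinality.
Require Import Defs.

(** Since the orders of the groups A(b, a) are invertible in k, averaging over
    the shears is an idempotent whose kernel consists of the elements dying in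
    the coinvariants; moreover F -> bar_tau_b F is injective. Hence
    bar_delta_b F (a) is the quotient of F (b (+) a) by the kernel of an
    idempotent of k[A(b (+) a, b (+) a)], and by iteration F lies in F_d if and
    only if a family of idempotents e of the rings k[A(y, y)] acts by zero on F;
    up to isomorphism of y the family is small.

    For such a family, a morphism is invertible modulo the subcategory iff it
    is bijective on the subspaces e F(y). Therefore the projective functors
    k[A(y, -)] e are colocal and the functors of linear maps
    e k[A(-, y)] -> V are local. Every F receives a morphism, invertible modulo
    the subcategory, from an explicit quotient of a sum of the former, and maps
    by such a morphism to an explicit subfunctor of a product of the latter;
    this provides the two adjoints. *)

Set Implicit Arguments.
Unset Strict Implicit.
Unset Printing Implicit Defensive.

Import GRing.Theory.
Local Open Scope ring_scope.
Local Open Scope cat_scope.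

(** * Adjoints of localization functors *)

Section Reflection.
Variables (C : category) (W : forall x y : C, hom x y -> Prop).

Definition local (r : C) : Prop :=
  forall (x y : C) (w : hom x y), W w -> forall g : hom x r,
    exists! h : hom y r, h \oc w = g.

Hypothesis refl : forall x : C, exists r, exists f : hom x r, W f /\ local r.

Let R (x : C) : C := projT1 (cid (refl x)).
Let eta (x : C) : hom x (R x) := projT1 (cid (projT2 (cid (refl x)))).
Let Weta x : W (eta x).
Proof. exact: (projT2 (cid (projT2 (cid (refl x))))).1. Qed.
Let Rlocal x : local (R x).
Proof. exact: (projT2 (cid (projT2 (cid (refl x))))).2. Qed.

Let ext x y z (w : hom x y) (Ww : W w) (g : hom x (R z)) : hom y (R z) :=
  projT1 (cid (Rlocal Ww g)).
Let extP x y z (w : hom x y) (Ww : W w) (g : hom x (R z)) : ext Ww g \oc w = g.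
Proof. exact: (projT2 (cid (Rlocal Ww g))).1. Qed.
Let ext_uniq x y z (w : hom x y) : W w -> forall h h' : hom y (R z),
  h \oc w = h' \oc w -> h = h'.
Proof.
by move=> Ww h h' e; have [u [_ U]] := Rlocal Ww (h \oc w); rewrite -(U h) ?(U h').
Qed.

Let ext_id x : ext (Weta x) (eta x \oc idm x) = idm (R x).
Proof. by apply: (ext_uniq (Weta x)); rewrite extP compm1 comp1m. Qed.

Let Fixpoint wmap x y (p : word W x y) : hom (R x) (R y) :=
  match p with
  | w_mor x y f => ext (Weta x) (eta y \oc f)
  | w_inv x y f Wf => ext (Weta y) (ext Wf (eta x))
  | w_comp x y z q p => wmap q \oc wmap p
  end.

(** A morphism into a reflection is determined by its composite with any member of [W]. The
    relations involving [W] or composites are therefore checked after composition with some [eta],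
    and for [we_Kinv] also with [f]. *)
Let wmap_eq x y (p q : word W x y) : word_eq p q -> wmap p = wmap q.
Proof.
elim=> {x y p q} //=.
- by move=> x y p q r _ -> _ ->.
- by move=> x y z q q' p p' _ -> _ ->.
- by move=> *; rewrite compmA.
- by move=> x y p; rewrite ext_id comp1m.
- by move=> x y p; rewrite ext_id compm1.
- move=> x y z g f; apply: (ext_uniq (Weta x)).
  by rewrite -compmA !extP !compmA extP.
- move=> x y f Wf; apply: (ext_uniq (Weta x)).
  by rewrite ext_id comp1m -compmA extP compmA !extP.
- move=> x y f Wf; apply: (ext_uniq (Weta y)).
  rewrite ext_id comp1m -compmA extP; apply: (ext_uniq Wf).
  by rewrite -compmA extP extP.
Qed.

Let cmap x y (c : loc_hom W x y) : hom (R x) (R y) := wmap (class_repr c).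
Let cmapE x y (p : word W x y) : cmap (loc_class p) = wmap p.
Proof. by apply: wmap_eq; apply/loc_classP/loc_classK. Qed.

Let refl_functor : functor (localization W) C.
Proof.
exists (R : localization W -> C) (fun (x y : localization W) (c : hom x y) => cmap c).
- by move=> x; rewrite /= cmapE /= ext_id.
- by move=> x y z g f; rewrite /= /loc_comp cmapE.
Defined.

Let refl_unit : nat_trans (id_functor C) (comp_functor refl_functor (loc_functor W)).
Proof. by exists eta => x y f; rewrite /= cmapE /= extP. Defined.

Let refl_counit :
  nat_trans (comp_functor (loc_functor W) refl_functor) (id_functor (localization W)).
Proof.
exists (fun x : localization W => loc_class (w_inv (Weta x))) => x y c.
rewrite -[c in RHS]loc_classK /= /cmap; set p := class_repr c.
rewrite !loc_compE; apply/loc_classP.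
(* Naturality concerns all morphisms of the localization, so it is proved on representing words, by
   induction on their construction. *)
elim: p => {x y c} [x y f|x y f Wf|x y z q IHq p IHp].
- (* Insert [eta x \oc (eta x)^-1] on the right and use [ext w g \oc w = g]. *)
  apply: we_trans (we_sym (we_compw1 _)) _.
  apply: we_trans (we_comp (we_refl _) (we_sym (we_Kinv (Weta x)))) _.
  apply: we_trans (we_compA _ _ _) _; apply: we_comp; last exact: we_refl.
  apply: we_trans (we_sym (we_compA _ _ _)) _.
  apply: we_trans (we_comp (we_refl _) (we_sym (we_mor _ _ _))) _.
  rewrite /= extP; apply: we_trans (we_comp (we_refl _) (we_mor _ _ _)) _.
  apply: we_trans (we_compA _ _ _) _.
  apply: we_trans (we_comp (we_invK _) (we_refl _)) _; exact: we_comp1w.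
(* The same insertion is made twice: [eta y] with its formal inverse strips the outer [ext] of
   [wmap], then [f] with its formal inverse strips the inner one. *)
- apply: we_trans (we_sym (we_compw1 _)) _.
  apply: we_trans (we_comp (we_refl _) (we_sym (we_Kinv (Weta y)))) _.
  apply: we_trans (we_compA _ _ _) _; apply: we_comp; last exact: we_refl.
  apply: we_trans (we_sym (we_compA _ _ _)) _.
  apply: we_trans (we_comp (we_refl _) (we_sym (we_mor _ _ _))) _.
  rewrite /= extP.
  apply: we_trans (we_sym (we_compw1 _)) _.
  apply: we_trans (we_comp (we_refl _) (we_sym (we_Kinv Wf))) _.
  apply: we_trans (we_compA _ _ _) _.
  apply: we_trans (we_comp (we_sym (we_compA _ _ _)) (we_refl _)) _.
  apply: we_trans (we_comp (we_comp (we_refl _) (we_sym (we_mor _ _ _))) (we_refl _)) _.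
  rewrite extP; apply: we_trans (we_comp (we_invK _) (we_refl _)) _.
  exact: we_comp1w.
- apply: we_trans (we_comp (we_refl _) (we_mor _ _ _)) _.
  apply: we_trans (we_compA _ _ _) _.
  apply: we_trans (we_comp IHq (we_refl _)) _.
  apply: we_trans (we_sym (we_compA _ _ _)) _.
  apply: we_trans (we_comp (we_refl _) IHp) _.
  exact: we_compA.
Defined.

(** For maps into local objects, [W] is already invertible, so [x] going to [R x] is functorial on
    the localization. The unit is [eta] and the counit is its formal inverse. *)
Lemma reflection_right_adjoint : has_right_adjoint (loc_functor W).
Proof.
exists refl_functor; constructor; exists refl_unit refl_counit.
- move=> x; rewrite /= loc_compE; apply/loc_classP; exact: we_invK.
- move=> x; rewrite /= cmapE /=; apply: (ext_uniq (Weta x)).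
  by rewrite extP extP comp1m.
Qed.

End Reflection.

(** * Coreflections: the dual construction, giving left adjoints *)

Section Coreflection.
Variables (C : category) (W : forall x y : C, hom x y -> Prop).

Definition colocal (l : C) : Prop :=
  forall (x y : C) (w : hom x y), W w -> forall g : hom l y,
    exists! h : hom l x, w \oc h = g.

Hypothesis corefl : forall x : C, exists l, exists f : hom l x, W f /\ colocal l.

Let L (x : C) : C := projT1 (cid (corefl x)).
Let eps (x : C) : hom (L x) x := projT1 (cid (projT2 (cid (corefl x)))).
Let Weps x : W (eps x).
Proof. exact: (projT2 (cid (projT2 (cid (corefl x))))).1. Qed.
Let Lcolocal x : colocal (L x).
Proof. exact: (projT2 (cid (projT2 (cid (corefl x))))).2. Qed.

Let lft x y z (w : hom x y) (Ww : W w) (g : hom (L z) y) : hom (L z) x :=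
  projT1 (cid (Lcolocal Ww g)).
Let lftP x y z (w : hom x y) (Ww : W w) (g : hom (L z) y) : w \oc lft Ww g = g.
Proof. exact: (projT2 (cid (Lcolocal Ww g))).1. Qed.
Let lft_uniq x y z (w : hom x y) : W w -> forall h h' : hom (L z) x,
  w \oc h = w \oc h' -> h = h'.
Proof.
by move=> Ww h h' e; have [u [_ U]] := Lcolocal Ww (w \oc h); rewrite -(U h) ?(U h').
Qed.

Let lft_id x : lft (Weps x) (idm x \oc eps x) = idm (L x).
Proof. by apply: (lft_uniq (Weps x)); rewrite lftP compm1 comp1m. Qed.

Let Fixpoint wmap x y (p : word W x y) : hom (L x) (L y) :=
  match p with
  | w_mor x y f => lft (Weps y) (f \oc eps x)
  | w_inv x y f Wf => lft (Weps x) (lft Wf (eps y))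
  | w_comp x y z q p => wmap q \oc wmap p
  end.

Let wmap_eq x y (p q : word W x y) : word_eq p q -> wmap p = wmap q.
Proof.
elim=> {x y p q} //=.
- by move=> x y p q r _ -> _ ->.
- by move=> x y z q q' p p' _ -> _ ->.
- by move=> *; rewrite compmA.
- by move=> x y p; rewrite lft_id comp1m.
- by move=> x y p; rewrite lft_id compm1.
- move=> x y z g f; apply: (lft_uniq (Weps z)).
  by rewrite compmA !lftP -!compmA lftP.
- move=> x y f Wf; apply: (lft_uniq (Weps x)).
  rewrite lft_id compm1 compmA lftP; apply: (lft_uniq Wf).
  by rewrite compmA lftP lftP.
- move=> x y f Wf; apply: (lft_uniq (Weps y)).
  by rewrite lft_id compm1 compmA lftP -compmA !lftP.
Qed.

Let cmap x y (c : loc_hom W x y) : hom (L x) (L y) := wmap (class_repr c).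
Let cmapE x y (p : word W x y) : cmap (loc_class p) = wmap p.
Proof. by apply: wmap_eq; apply/loc_classP/loc_classK. Qed.

Let corefl_functor : functor (localization W) C.
Proof.
exists (L : localization W -> C) (fun (x y : localization W) (c : hom x y) => cmap c).
- by move=> x; rewrite /= cmapE /= lft_id.
- by move=> x y z g f; rewrite /= /loc_comp cmapE.
Defined.

Let corefl_counit :
  nat_trans (comp_functor corefl_functor (loc_functor W)) (id_functor C).
Proof. by exists eps => x y f; rewrite /= cmapE /= lftP. Defined.

Let corefl_unit :
  nat_trans (id_functor (localization W)) (comp_functor (loc_functor W) corefl_functor).
Proof.
exists (fun x : localization W => loc_class (w_inv (Weps x))) => x y c.
rewrite -[c in LHS]loc_classK /= /cmap; set p := class_repr c.
rewrite !loc_compE; apply/loc_classP; apply: we_sym.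
elim: p => {x y c} [x y f|x y f Wf|x y z q IHq p IHp].
- apply: we_trans (we_sym (we_comp1w _)) _.
  apply: we_trans (we_comp (we_sym (we_invK (Weps y))) (we_refl _)) _.
  apply: we_trans (we_sym (we_compA _ _ _)) _; apply: we_comp; first exact: we_refl.
  apply: we_trans (we_compA _ _ _) _.
  apply: we_trans (we_comp (we_sym (we_mor _ _ _)) (we_refl _)) _.
  rewrite /= lftP; apply: we_trans (we_comp (we_mor _ _ _) (we_refl _)) _.
  apply: we_trans (we_sym (we_compA _ _ _)) _.
  apply: we_trans (we_comp (we_refl _) (we_Kinv _)) _; exact: we_compw1.
- apply: we_trans (we_sym (we_comp1w _)) _.
  apply: we_trans (we_comp (we_sym (we_invK (Weps x))) (we_refl _)) _.
  apply: we_trans (we_sym (we_compA _ _ _)) _; apply: we_comp; first exact: we_refl.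
  apply: we_trans (we_compA _ _ _) _.
  apply: we_trans (we_comp (we_sym (we_mor _ _ _)) (we_refl _)) _.
  rewrite /= lftP.
  apply: we_trans (we_sym (we_comp1w _)) _.
  apply: we_trans (we_comp (we_sym (we_invK Wf)) (we_refl _)) _.
  apply: we_trans (we_sym (we_compA _ _ _)) _.
  apply: we_trans (we_comp (we_refl _) (we_compA _ _ _)) _.
  apply: we_trans (we_comp (we_refl _) (we_comp (we_sym (we_mor _ _ _)) (we_refl _))) _.
  rewrite lftP; apply: we_trans (we_comp (we_refl _) (we_Kinv _)) _.
  exact: we_compw1.
- apply: we_trans (we_comp (we_mor _ _ _) (we_refl _)) _.
  apply: we_trans (we_sym (we_compA _ _ _)) _.
  apply: we_trans (we_comp (we_refl _) IHp) _.
  apply: we_trans (we_compA _ _ _) _.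
  apply: we_trans (we_comp IHq (we_refl _)) _.
  exact: we_sym (we_compA _ _ _).
Defined.

(** Lifting along [W] replaces extension along [W]: now [eps] is the counit, and its formal inverse
    is the unit. *)
Lemma coreflection_left_adjoint : has_left_adjoint (loc_functor W).
Proof.
exists corefl_functor; constructor; exists corefl_unit corefl_counit.
- move=> x; rewrite /= cmapE /=; apply: (lft_uniq (Weps x)).
  by rewrite lftP lftP compm1.
- move=> x; rewrite /= loc_compE; apply/loc_classP; exact: we_Kinv.
Qed.

End Coreflection.

(** * Kernels and cokernels of functors to vector spaces *)

Section SubSpace.
Variables (k : fieldType) (V : lmodType k) (S : submodClosed V).

Definition sub_pred : {pred V} := S.
HB.instance Definition _ := GRing.isSubmodClosed.Build k V sub_pred
  (GRing.submodClosedP S).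

Definition sub_space := {v : V | v \in sub_pred}.
HB.instance Definition _ := SubType.on sub_space.
HB.instance Definition _ := [Choice of sub_space by <:].
HB.instance Definition _ := [SubChoice_isSubLmodule of sub_space by <:].

Definition sub_val : {linear sub_space -> V} := val.

End SubSpace.

Section PointwiseVect.
Variables (C : category) (k : fieldType).
Implicit Types F G H : functor C (vect_cat k).

Lemma nlinP F G (s t : nat_trans F G) :
  (forall x v, nlin s x v = nlin t x v) -> s = t.
Proof. by move=> st; apply: nat_transP => x; apply: linearP_ext => v; apply: st. Qed.

Lemma nlin_eq F G (s t : nat_trans F G) : s = t ->
  forall x v, nlin s x v = nlin t x v.
Proof. by move->. Qed.

Section MkNt.
Variables (F G : functor C (vect_cat k)) (t : forall x, fsp F x -> fsp G x).
Hypotheses (tlin : forall x, linear (@t x))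
  (tnat : forall x y (f : hom x y) v, t (flin F f v) = flin G f (t v)).

Definition mk_lin x : {linear fsp F x -> fsp G x} :=
  HB.pack (@t x) (GRing.isLinear.Build _ _ _ _ _ (@tlin x)).

Definition mk_nt : nat_trans F G.
Proof.
exists (fun x => mk_lin x) => x y f; apply: linearP_ext => v; exact: tnat.
Defined.

Lemma mk_ntE x v : nlin mk_nt x v = t v.
Proof. by []. Qed.

End MkNt.

Definition zero_nt F G : nat_trans F G.
Proof.
apply: (@mk_nt F G (fun x _ => 0)) => [x a u v|x y f v].
- by rewrite scaler0 addr0.
- by rewrite linear0.
Defined.

(** Preimages under an injection are unique, so the pointwise choice [s] is automatically linear and
    natural. *)
Lemma nt_lift F G H (i : nat_trans H F) (t : nat_trans G F) :
  (forall x, injective (nlin i x)) ->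
  (forall x v, exists u, nlin i x u = nlin t x v) ->
  exists s : nat_trans G H, forall x v, nlin i x (nlin s x v) = nlin t x v.
Proof.
move=> inj_i it; pose s x v := projT1 (cid (it x v)).
have sE x v : nlin i x (s x v) = nlin t x v := projT2 (cid (it x v)).
have slin x : linear (s x) by move=> a u v; apply: inj_i; rewrite linearP !sE linearP.
have snat x y (f : hom x y) v : s y (flin G f v) = flin H f (s x v).
  by apply: inj_i; rewrite sE !nlin_nat sE.
by exists (mk_nt slin snat) => x v; rewrite mk_ntE.
Qed.

(** Two preimages under [p] differ by an element that [t] kills, so the chosen section [r] does not
    affect the value; linearity and naturality follow. *)
Lemma nt_descend F G Q (p : nat_trans F Q) (t : nat_trans F G) :
  (forall x v, exists u, nlin p x u = v) ->
  (forall x v, nlin p x v = 0 -> nlin t x v = 0) ->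
  exists s : nat_trans Q G, forall x v, nlin s x (nlin p x v) = nlin t x v.
Proof.
move=> psurj pt; pose r x v := projT1 (cid (psurj x v)).
have rE x v : nlin p x (r x v) = v := projT2 (cid (psurj x v)).
have tE x u v : nlin p x u = nlin p x v -> nlin t x u = nlin t x v.
  move=> e; apply/eqP; rewrite -subr_eq0 -linearB; apply/eqP/pt.
  by rewrite linearB e subrr.
have slin x : linear (fun v => nlin t x (r x v)).
  by move=> a u v; rewrite -linearP; apply: tE; rewrite linearP !rE.
have snat x y (f : hom x y) v :
    nlin t y (r y (flin Q f v)) = flin G f (nlin t x (r x v)).
  by rewrite -nlin_nat; apply: tE; rewrite nlin_nat !rE.
by exists (mk_nt slin snat) => x v; rewrite mk_ntE; apply: tE; rewrite rE.
Qed.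

Section SubFunctor.
Variables (F : functor C (vect_cat k)) (S : subfunctor F).

Let res x y (f : hom x y) (v : sub_space (sub_at S x)) : sub_space (sub_at S y) :=
  exist _ (flin F f (val v)) (sub_stable f (valP v)).

Fact sub_map_linear x y (f : hom x y) : linear (res f).
Proof. by move=> a u v; apply: val_inj; rewrite /= !linearP. Qed.

Definition sub_map x y (f : hom x y) :
    {linear sub_space (sub_at S x) -> sub_space (sub_at S y)} :=
  HB.pack (res f) (GRing.isLinear.Build _ _ _ _ _ (sub_map_linear f)).

Definition sub_functor : functor C (vect_cat k).
Proof.
exists (fun x => sub_space (sub_at S x) : lmodType k) sub_map.
- by move=> x; apply: linearP_ext => v; apply: val_inj; rewrite /= flin1.
- by move=> x y z g f; apply: linearP_ext => v; apply: val_inj; rewrite /= flinM.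
Defined.

Definition sub_incl : nat_trans sub_functor F.
Proof.
by exists (fun x => @sub_val k _ (sub_at S x)) => x y f; apply: linearP_ext.
Defined.

Lemma sub_incl_inj x : injective (nlin sub_incl x).
Proof. exact: val_inj. Qed.

Lemma sub_incl_in x u : nlin sub_incl x u \in sub_at S x.
Proof. exact: (valP u). Qed.

Lemma sub_incl_onto x (v : fsp F x) : v \in sub_at S x ->
  exists u, nlin sub_incl x u = v.
Proof. by move=> vS; exists (exist _ v vS). Qed.

Lemma quot_proj_surj x v : exists u, nlin (quot_proj S) x u = v.
Proof. by exists (repr v); rewrite /nlin /= quot_piK. Qed.

Lemma quot_proj0 x (v : fsp F x) : nlin (quot_proj S) x v = 0 <-> v \in sub_at S x.
Proof.
have -> : nlin (quot_proj S) x v = quot_pi (sub_at S x) v by [].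
by rewrite -(linear0 (quot_pi (sub_at S x))) quot_piP subr0.
Qed.

End SubFunctor.

Section KerSub.
Variables (F G : functor C (vect_cat k)) (t : nat_trans F G).

Let ker x : {pred fsp F x} := fun v => nlin t x v == 0.

Fact ker_submod_closed x : submod_closed (@ker x).
Proof.
split=> [|a u v]; rewrite ![_ \in @ker x]unfold_in ?linear0 // linearP.
by move=> /eqP-> /eqP->; rewrite scaler0 addr0.
Qed.

Definition ker_at x : submodClosed (fsp F x) :=
  HB.pack (@ker x) (GRing.isSubmodClosed.Build k _ (@ker x) (ker_submod_closed x)).

Definition ker_sub : subfunctor F.
Proof.
exists ker_at => x y f v; rewrite ![_ \in _]unfold_in /ker nlin_nat => /eqP->.
by rewrite linear0.
Defined.

End KerSub.

Lemma in_ker_sub F G (t : nat_trans F G) x v :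
  v \in sub_at (ker_sub t) x <-> nlin t x v = 0.
Proof. by split=> [/eqP|/eqP]. Qed.

Lemma in_image F G (t : nat_trans F G) x v :
  v \in sub_at (image_functor t) x <-> exists u, nlin t x u = v.
Proof. by split=> /asboolP. Qed.

Lemma fun_vect_zeroP (F : fun_vect C k) :
  is_zero_object F <-> forall x (v : fsp F x), v = 0.
Proof.
split=> [[/(_ F)[h [_ h1]] _] x v|F0].
  have -> : v = nlin (idm F : nat_trans F F) x v by [].
  by rewrite -(h1 (idm F)) // (h1 (zero_nt F F)).
split=> G; exists (zero_nt _ _); split=> // t _; apply: nlinP => x v.
- by rewrite [RHS]F0.
- by rewrite [v]F0 !linear0.
Qed.

Lemma fun_vect_zero_morP (F G : fun_vect C k) (t : hom F G) :
  is_zero_mor t <-> forall x v, nlin (t : nat_trans F G) x v = 0.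
Proof.
split=> [[Z [/fun_vect_zeroP Z0 [g [h ->]]]] x v|t0].
  by rewrite -(linear0 (nlin (h : nat_trans Z G) x)) -(Z0 x (nlin (g : nat_trans F Z) x v)).
(* A zero object to factor through is obtained as the kernel of the identity of [F]. *)
pose Z : fun_vect C k := sub_functor (ker_sub (nt_id F)).
exists Z; split.
  apply/fun_vect_zeroP => x v; apply: sub_incl_inj; rewrite linear0.
  by have /in_ker_sub := sub_incl_in v.
exists (zero_nt F Z), (zero_nt Z G); apply: nlinP => x v; exact: t0.
Qed.

(** Monicity is tested on the inclusion of the pointwise kernel against the zero map; epimorphisms
    are treated dually below, with the projection onto the cokernel. *)
Lemma monic_inj (F G : fun_vect C k) (t : hom F G) :
  monic t -> forall x, injective (nlin (t : nat_trans F G) x).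
Proof.
move=> tm x u v e; apply/eqP; rewrite -subr_eq0; apply/eqP.
pose i : nat_trans _ F := sub_incl (ker_sub t).
have /nlin_eq i0 : i = zero_nt _ _.
  apply: (tm _ i (zero_nt _ F)); apply: nlinP => y w.
  have -> : nlin (t \oc zero_nt _ F : nat_trans _ G) y w = 0 := linear0 _.
  by have /in_ker_sub := sub_incl_in w.
have [|w <-] := @sub_incl_onto _ (ker_sub t) x (u - v); last exact: i0.
by apply/in_ker_sub; rewrite linearB e subrr.
Qed.

Lemma epic_surj (F G : fun_vect C k) (t : hom F G) :
  epic t -> forall x v, exists u, nlin (t : nat_trans F G) x u = v.
Proof.
move=> te x v; apply/in_image/quot_proj0.
pose p : nat_trans G _ := quot_proj (image_functor t).
have /nlin_eq-> // : p = zero_nt _ _.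
apply: (te _ p (zero_nt G _)); apply: nlinP => y w.
by apply/quot_proj0/in_image; exists w.
Qed.

(** The inclusion of the explicit kernel [ker_sub t] factors through every categorical kernel, which
    therefore reaches all elements killed by [t]. *)
Lemma kernel_exact (N F G : fun_vect C k) (i : hom N F) (t : hom F G) :
  is_kernel i t -> forall x v, nlin (t : nat_trans F G) x v = 0 ->
  exists u, nlin (i : nat_trans N F) x u = v.
Proof.
move=> [_ iu] x v tv.
have [|h [hE _]] := iu _ (sub_incl (ker_sub t)).
  by apply/fun_vect_zero_morP => y w; have /in_ker_sub := sub_incl_in w.
have [|w <-] := @sub_incl_onto _ (ker_sub t) x v; first exact/in_ker_sub.
by exists (nlin (h : nat_trans _ N) x w); rewrite -(nlin_eq hE).
Qed.

Lemma ker_sub_kernel (F G : fun_vect C k) (t : hom F G) :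
  @is_kernel (fun_vect C k) _ _ _ (sub_incl (ker_sub t)) t.
Proof.
split; first by apply/fun_vect_zero_morP => y w; have /in_ker_sub := sub_incl_in w.
move=> H g /fun_vect_zero_morP tg.
have [|h hE] := @nt_lift _ H _ (sub_incl (ker_sub t)) g (@sub_incl_inj _ _).
  by move=> x v; apply/sub_incl_onto/in_ker_sub/tg.
exists h; split=> [|h' e]; first exact: nlinP.
by apply: nlinP => x v; apply: sub_incl_inj; rewrite hE -(nlin_eq e).
Qed.

Lemma image_cokernel (F G : fun_vect C k) (t : hom F G) :
  @is_cokernel (fun_vect C k) _ _ _ (quot_proj (image_functor t)) t.
Proof.
split.
  by apply/fun_vect_zero_morP => y w; apply/quot_proj0/in_image; exists w.
move=> H g /fun_vect_zero_morP gt.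
have [|h hE] := @nt_descend _ H _ _ g (@quot_proj_surj _ (image_functor t)).
  by move=> x v /quot_proj0/in_image[u <-]; apply: gt.
exists h; split=> [|h' e]; first exact: nlinP.
apply: nlinP => x v; have [u <-] := quot_proj_surj v.
by rewrite hE -(nlin_eq e).
Qed.

(** The projection onto the explicit cokernel factors through [p], so what [p] kills lies in the
    image of [t]. *)
Lemma cokernel_exact (F G Q : fun_vect C k) (p : hom G Q) (t : hom F G) :
  is_cokernel p t -> forall x v, nlin (p : nat_trans G Q) x v = 0 ->
  exists u, nlin (t : nat_trans F G) x u = v.
Proof.
move=> [_ pu] x v pv.
have [|h [hE _]] := pu _ (quot_proj (image_functor t)).
  by apply/fun_vect_zero_morP => y w; apply/quot_proj0/in_image; exists w.
apply/in_image/quot_proj0; rewrite -(nlin_eq hE).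
by rewrite -(linear0 (nlin (h : nat_trans Q _) x)) -pv.
Qed.

End PointwiseVect.

(** * Products of vector spaces and free vector spaces *)

Section DependentProduct.
Variables (k : fieldType) (I : Type) (V : I -> lmodType k).

Definition dprod := forall i, V i.
HB.instance Definition _ := gen_eqMixin dprod.
HB.instance Definition _ := gen_choiceMixin dprod.

Let add (u v : dprod) : dprod := fun i => u i + v i.
Let opp (u : dprod) : dprod := fun i => - u i.
Let scale (a : k) (u : dprod) : dprod := fun i => a *: u i.

Fact dprod_addA : associative add.
Proof. by move=> u v w; apply: functional_extensionality_dep => i; apply: addrA. Qed.
Fact dprod_addC : commutative add.
Proof. by move=> u v; apply: functional_extensionality_dep => i; apply: addrC. Qed.
Fact dprod_add0 : left_id ((fun=> 0) : dprod) add.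
Proof. by move=> u; apply: functional_extensionality_dep => i; apply: add0r. Qed.
Fact dprod_addN : left_inverse ((fun=> 0) : dprod) opp add.
Proof. by move=> u; apply: functional_extensionality_dep => i; apply: addNr. Qed.

HB.instance Definition _ :=
  GRing.isZmodule.Build dprod dprod_addA dprod_addC dprod_add0 dprod_addN.

Fact dprod_scaleA a b u : scale a (scale b u) = scale (a * b) u.
Proof. by apply: functional_extensionality_dep => i; apply: scalerA. Qed.
Fact dprod_scale1 : left_id 1 scale.
Proof. by move=> u; apply: functional_extensionality_dep => i; apply: scale1r. Qed.
Fact dprod_scaleDr : right_distributive scale +%R.
Proof. by move=> a u v; apply: functional_extensionality_dep => i; apply: scalerDr. Qed.
Fact dprod_scaleDl u : {morph scale^~ u : a b / a + b}.
Proof. by move=> a b; apply: functional_extensionality_dep => i; apply: scalerDl. Qed.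

HB.instance Definition _ := GRing.Zmodule_isLmodule.Build k dprod
  dprod_scaleA dprod_scale1 dprod_scaleDr dprod_scaleDl.

Definition dproj i (u : dprod) : V i := u i.
Fact dproj_linear i : linear (dproj i). Proof. by []. Qed.
HB.instance Definition _ i :=
  GRing.isLinear.Build k dprod (V i) *:%R (dproj i) (dproj_linear i).

Lemma dprodP (u v : dprod) : (forall i, dproj i u = dproj i v) -> u = v.
Proof. exact: functional_extensionality_dep. Qed.

End DependentProduct.

Section FreeModule.
Variables (k : fieldType) (X : Type).

Let fn := dprod (fun _ : X => k^o).

Let cf (u : fn) (x : X) : k := u x.

Let fin_supp : {pred fn} := fun u =>
  `[< exists r : seq {classic X}, forall x, cf u x != 0 -> (x : {classic X}) \in r >].

Fact fin_supp_closed : submod_closed fin_supp.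
Proof.
split; first by apply/asboolP; exists [::] => x; rewrite /cf eqxx.
move=> a u v /asboolP[r rP] /asboolP[s sP]; apply/asboolP; exists (r ++ s) => x.
rewrite mem_cat; apply: contraNT; rewrite negb_or => /andP[xr xs].
have -> : cf (a *: u + v) x = a * cf u x + cf v x by [].
have -> : cf u x = 0 by exact: (contraNeq (rP x) xr).
have -> : cf v x = 0 by exact: (contraNeq (sP x) xs).
by rewrite mulr0 addr0.
Qed.

Definition fin_supp_sub : submodClosed fn :=
  HB.pack fin_supp (GRing.isSubmodClosed.Build k _ fin_supp fin_supp_closed).

Definition free_mod : lmodType k := sub_space fin_supp_sub.

Let coef (u : free_mod) (x : X) : k := cf (val u) x.

Let supp_ex (u : free_mod) :
  exists r : seq {classic X}, uniq r /\ forall x : {classic X}, coef u x != 0 -> x \in r.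
Proof.
have /asboolP[r rP] := valP u.
exists (undup r); split=> [|x cx]; first exact: undup_uniq.
by rewrite mem_undup; apply: rP.
Qed.

Let supp u : seq {classic X} := projT1 (cid (supp_ex u)).

Fact single_subproof (x : X) :
  ((fun y => (`[< y = x >])%:R) : fn) \in fin_supp.
Proof.
apply/asboolP; exists [:: x] => y; rewrite mem_seq1 /cf.
by case: asboolP => [->|]; rewrite eqxx.
Qed.

Definition single (x : X) : free_mod :=
  exist (fun u : fn => u \in sub_pred fin_supp_sub) _ (single_subproof x).

(** The enumeration [supp u] is an arbitrary choice and may contain zeros of [u]. Discarding the
    zero coefficients shows that every duplicate-free list covering the support gives the same sum,
    so sums for several elements can be taken over one common list. *)
Let sum_supp (V : lmodType k) (g : X -> V) (u : free_mod) (r : seq {classic X}) :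
  uniq r -> (forall x : {classic X}, coef u x != 0 -> x \in r) ->
  \sum_(x <- supp u) coef u x *: g x = \sum_(x <- r) coef u x *: g x.
Proof.
move=> ur rP; have [us sP] := projT2 (cid (supp_ex u)).
have red (s : seq {classic X}) : \sum_(x <- s) coef u x *: g x =
    \sum_(x <- [seq x <- s | coef u x != 0]) coef u x *: g x.
  rewrite big_filter [LHS](bigID (fun x => coef u x != 0)) /= [X in _ + X]big1 ?addr0 //.
  by move=> x /negPn/eqP->; rewrite scale0r.
rewrite red [RHS]red; apply: (@perm_big _ _ _ {classic X}).
apply: uniq_perm; rewrite ?filter_uniq //.
move=> x; rewrite !mem_filter; case: eqVneq => //= cx.
by rewrite sP // rP.
Qed.

Section Lift.
Variables (V : lmodType k) (g : X -> V).

Definition free_mod_lift (u : free_mod) : V := \sum_(x <- supp u) coef u x *: g x.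

Fact free_mod_lift_linear : linear free_mod_lift.
Proof.
move=> a u v; rewrite /free_mod_lift.
have [_ uP] := projT2 (cid (supp_ex u)); have [_ vP] := projT2 (cid (supp_ex v)).
have [_ wP] := projT2 (cid (supp_ex (a *: u + v))).
pose r := undup (supp u ++ supp v ++ supp (a *: u + v)).
have ur : uniq r := undup_uniq _.
rewrite (sum_supp g ur) => [|x /wP xs]; last by rewrite mem_undup !mem_cat xs !orbT.
rewrite (sum_supp g ur) => [|x /uP xs]; last by rewrite mem_undup !mem_cat xs.
rewrite (sum_supp g ur) => [|x /vP xs]; last by rewrite mem_undup !mem_cat xs orbT.
rewrite scaler_sumr -big_split; apply: eq_bigr => x _.
by rewrite [coef (_ + _) _]/(_ + _) scalerDl scalerA.
Qed.

HB.instance Definition _ :=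
  GRing.isLinear.Build k free_mod V *:%R free_mod_lift free_mod_lift_linear.

Lemma free_mod_lift_single x : free_mod_lift (single x) = g x.
Proof.
have cE y : coef (single x) y = (`[< y = x >])%:R by [].
rewrite /free_mod_lift (@sum_supp _ _ _ [:: x]) //.
  by rewrite big_seq1 cE asboolT // scale1r.
by move=> y; rewrite cE mem_seq1; case: asboolP => [->|]; rewrite eqxx.
Qed.

End Lift.

Lemma free_mod_ext (V : lmodType k) (f g : {linear free_mod -> V}) :
  (forall x, f (single x) = g (single x)) -> f =1 g.
Proof.
move=> fg u; have [us sP] := projT2 (cid (supp_ex u)).
have -> : u = \sum_(x <- supp u) coef u x *: single x.
  apply: val_inj; apply: dprodP => y.
  pose ev : {linear free_mod -> k^o} := dproj y \o sub_val fin_supp_sub.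
  have evE c x : ev (c *: single x) = c * (`[< y = x >])%:R by rewrite linearZ.
  rewrite -[LHS]/(coef u y) -[RHS]/(ev _) linear_sum.
  under eq_bigr do rewrite evE.
  have [ys|ys] := boolP ((y : {classic X}) \in supp u); last first.
    rewrite big_seq big1 => [|x xs]; first exact: (contraNeq (sP y) ys).
    by rewrite asboolF ?mulr0 // => e; rewrite e xs in ys.
  rewrite (bigD1_seq (y : {classic X})) //= big1_seq ?addr0.
    by rewrite asboolT // mulr1.
  by move=> x /andP[/eqP xy _]; rewrite asboolF ?mulr0 // => /esym.
by rewrite !linear_sum; apply: eq_bigr => x _; rewrite !linearZ fg.
Qed.

End FreeModule.

(** * Free and cofree functors *)

Section SmallHom.
(** [hs x y] is a copy of [hom x y] in the universe of the vector spaces, which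
    may be smaller than that of [hom]. *)
Variables (C : category) (k : fieldType) (hs : C -> C -> Type).
Variables (enc : forall x y, hom x y -> hs x y) (dec : forall x y, hs x y -> hom x y).
Hypotheses (encK : forall x y, cancel (@enc x y) (@dec x y))
  (decK : forall x y, cancel (@dec x y) (@enc x y)).

Section FreeFunctor.
Variables (X : Type) (src : X -> C).

Let gens (a : C) : Type := {s : X & hs (src s) a}.
Let elt a s (p : hom (src s) a) : free_mod k (gens a) :=
  single k (existT (fun s => hs (src s) a) s (enc p)).

Let act_gen a b (f : hom a b) (s : gens a) : free_mod k (gens b) :=
  elt (f \oc dec (projT2 s)).

Let ext_elt a (V : lmodType k) (f g : {linear free_mod k (gens a) -> V}) :
  (forall s (p : hom (src s) a), f (elt p) = g (elt p)) -> f =1 g.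
Proof.
move=> fg; apply: free_mod_ext => -[s h]; have := fg s (dec h).
by rewrite /elt decK.
Qed.

Let act_genE a b (f : hom a b) s (p : hom (src s) a) :
  free_mod_lift (act_gen f) (elt p) = elt (f \oc p).
Proof. by rewrite /elt free_mod_lift_single /act_gen /= encK. Qed.

(** This is the direct sum over [s] of the projective functors [k[hom (src s) -]]. *)
Definition free_functor : functor C (vect_cat k).
Proof.
exists (fun a => free_mod k (gens a))
  (fun a b f => free_mod_lift (act_gen f) : {linear _ -> _}).
- move=> a; apply: linearP_ext; apply: ext_elt => s p.
  by rewrite /= act_genE comp1m.
- move=> a b c g f; apply: linearP_ext; apply: ext_elt => s p.
  by rewrite /= !act_genE compmA.
Defined.

Definition free_gen s : fsp free_functor (src s) := elt (idm (src s)).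

Let free_genE s a (p : hom (src s) a) : flin free_functor p (free_gen s) = elt p.
Proof. by rewrite /flin /= /free_gen act_genE compm1. Qed.

Lemma free_functor_ext F (t u : nat_trans free_functor F) :
  (forall s, nlin t (src s) (free_gen s) = nlin u (src s) (free_gen s)) -> t = u.
Proof.
move=> tu; apply: nlinP => a; apply: (@ext_elt a) => s p.
by rewrite -free_genE !nlin_nat tu.
Qed.

(** Yoneda lemma: the basis element given by [p] must go to [F p] applied to [g s]. *)
Lemma free_functor_lift F (g : forall s, fsp F (src s)) :
  exists t : nat_trans free_functor F, forall s, nlin t (src s) (free_gen s) = g s.
Proof.
pose h a (s : gens a) := flin F (dec (projT2 s)) (g (projT1 s)).
have hE a s (p : hom (src s) a) : free_mod_lift (@h a) (elt p) = flin F p (g s).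
  by rewrite /elt free_mod_lift_single /h /= encK.
have hnat a b (f : hom a b) v :
    free_mod_lift (@h b) (flin free_functor f v) = flin F f (free_mod_lift (@h a) v).
  pose l := free_mod_lift (@h b) \o flin free_functor f : {linear _ -> _}.
  pose r := flin F f \o free_mod_lift (@h a) : {linear _ -> _}.
  apply: (@ext_elt a _ l r) => s p.
  rewrite -[LHS]/(free_mod_lift (@h b) (flin free_functor f (elt p))).
  rewrite -[RHS]/(flin F f (free_mod_lift (@h a) (elt p))).
  by rewrite hE -free_genE -flinM free_genE hE flinM.
have hlin a : linear (free_mod_lift (@h a) : fsp free_functor a -> fsp F a).
  exact: free_mod_lift_linear.
exists (mk_nt hlin hnat) => s.
by rewrite mk_ntE hE flin1.
Qed.

End FreeFunctor.

Section CofreeFunctor.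
Variables (X : Type) (tgt : X -> C) (V : X -> lmodType k).

Let coords (a : C) : Type := {s : X & hs a (tgt s)}.

Let pull a b (f : hom a b) (u : dprod (fun s : coords a => V (projT1 s))) :
    dprod (fun s : coords b => V (projT1 s)) :=
  fun s => dproj (existT (fun s => hs a (tgt s)) (projT1 s) (enc (dec (projT2 s) \oc f))) u.

Let pull_linear a b (f : hom a b) : linear (pull f).
Proof. by []. Qed.

Let pull_lin a b (f : hom a b) : {linear dprod (fun s : coords a => V (projT1 s)) ->
    dprod (fun s : coords b => V (projT1 s))} :=
  HB.pack (pull f) (GRing.isLinear.Build _ _ _ _ _ (pull_linear f)).

(** This is the product over [s] of the functors sending [a] to the linear maps from
    [k[hom a (tgt s)]] to [V s], the injective counterpart of [free_functor]. *)
Definition cofree_functor : functor C (vect_cat k).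
Proof.
exists (fun a => dprod (fun s : coords a => V (projT1 s)) : lmodType k) pull_lin.
- move=> a; apply: linearP_ext => u; apply: dprodP => -[s h].
  by rewrite /= /pull /dproj /= compm1 decK.
- move=> a b c g f; apply: linearP_ext => u; apply: dprodP => -[s h].
  by rewrite /= /pull /dproj /= encK compmA.
Defined.

Let coord_fun a s (p : hom a (tgt s)) (u : fsp cofree_functor a) : V s :=
  u (existT (fun s => hs a (tgt s)) s (enc p)).

Fact coord_linear a s (p : hom a (tgt s)) : linear (coord_fun p).
Proof. by []. Qed.

Definition coord a s (p : hom a (tgt s)) : {linear fsp cofree_functor a -> V s} :=
  HB.pack (coord_fun p) (GRing.isLinear.Build _ _ _ _ _ (coord_linear p)).

Lemma cofreeP a (u v : fsp cofree_functor a) :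
  (forall s (p : hom a (tgt s)), coord p u = coord p v) -> u = v.
Proof.
move=> uv; apply: dprodP => -[s h]; have := uv s (dec h).
by rewrite /= /coord_fun decK.
Qed.

Lemma coord_flin a b (f : hom a b) s (p : hom b (tgt s)) (u : fsp cofree_functor a) :
  coord p (flin cofree_functor f u) = coord (p \oc f) u.
Proof. by rewrite /= /coord_fun /flin /= /pull /dproj /= encK. Qed.

(** Dual Yoneda lemma: a transformation into the cofree functor amounts to a linear map
    [F (tgt s) -> V s] for each [s], read off at the identity. *)
Lemma cofree_functor_lift F (g : forall s, {linear fsp F (tgt s) -> V s}) :
  exists t : nat_trans F cofree_functor,
    forall a s (p : hom a (tgt s)) v, coord p (nlin t a v) = g s (flin F p v).
Proof.
pose h a (v : fsp F a) : fsp cofree_functor a :=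
  fun s => g (projT1 s) (flin F (dec (projT2 s)) v).
have hE a s (p : hom a (tgt s)) v : coord p (h a v) = g s (flin F p v).
  by rewrite /= /coord_fun /h /= encK.
have hlin a : linear (h a).
  by move=> c u v; apply: cofreeP => s p; rewrite linearP !hE !linearP.
have hnat a b (f : hom a b) v : h b (flin F f v) = flin cofree_functor f (h a v).
  by apply: cofreeP => s p; rewrite coord_flin !hE flinM.
by exists (mk_nt hlin hnat) => a s p v; rewrite mk_ntE hE.
Qed.

End CofreeFunctor.

End SmallHom.
(** * Functors killed by a family of idempotents *)

Section FormalCombinations.
Variables (C : category) (k : fieldType).

(** Unreduced representatives of the elements of [k[hom y z]]. *)
Definition combo (y z : C) : Type := seq (k * hom y z).

Section Action.
Variables (F : functor C (vect_cat k)) (y z : C) (c : combo y z).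

Let act_fun (v : fsp F y) : fsp F z := \sum_(t <- c) t.1 *: flin F t.2 v.

Fact act_linear : linear act_fun.
Proof.
move=> a u v; rewrite /act_fun scaler_sumr -big_split; apply: eq_bigr => t _.
by rewrite linearP scalerDr !scalerA mulrC.
Qed.

Definition act : {linear fsp F y -> fsp F z} :=
  HB.pack act_fun (GRing.isLinear.Build _ _ _ _ _ act_linear).

Lemma actE v : act v = \sum_(t <- c) t.1 *: flin F t.2 v.
Proof. by []. Qed.

End Action.

Lemma nlin_act (F G : functor C (vect_cat k)) (t : nat_trans F G) (y z : C)
  (c : combo y z) (v : fsp F y) : nlin t z (act F c v) = act G c (nlin t y v).
Proof.
by rewrite !actE linear_sum; apply: eq_bigr => s _; rewrite linearZ nlin_nat.
Qed.

Lemma act_prod (F : functor C (vect_cat k)) (x y z : C)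
  (d : combo y z) (c : combo x y) (v : fsp F x) :
  act F [seq (s.1 * t.1, s.2 \oc t.2) | s <- d, t <- c] v = act F d (act F c v).
Proof.
rewrite !actE big_allpairs_dep; apply: eq_bigr => s _.
rewrite (linear_sum (flin F s.2)) scaler_sumr; apply: eq_bigr => t _.
by rewrite flinM linearZ scalerA.
Qed.

End FormalCombinations.

Section IdempotentFamily.
Variables (C : category) (k : fieldType) (T : Type) (y : T -> C).
Variable e : forall i, combo k (y i) (y i).
Hypothesis idem : forall i (F : functor C (vect_cat k)) v,
  act F (e i) (act F (e i) v) = act F (e i) v.

(** The common kernel of the functors sending [F] to the image of [e i] on [F (y i)], which are
    exact because [e i] acts as an idempotent. *)
Definition annih (F : fun_vect C k) : Prop :=
  forall i (v : fsp F (y i)), act F (e i) v = 0.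

Lemma annih_thick : thick annih.
Proof.
split=> [F G t /monic_inj t_inj G0|F G t /epic_surj t_surj F0|F G H i p].
- by move=> j v; apply: t_inj; rewrite nlin_act G0 linear0.
- by move=> j v; have [u <-] := t_surj _ v; rewrite -nlin_act F0 linear0.
- move=> [ip _] F0 H0 j v.
  (* Idempotency settles extensions: [e v] comes from some [u] of the subobject, and a second
     application of [e] kills it. *)
  have [u uE] : exists u, nlin (i : nat_trans F G) _ u = act G (e j) v.
    by apply: (kernel_exact ip); rewrite nlin_act H0.
  by rewrite -idem -uE -nlin_act F0 linear0.
Qed.

(** The image of an idempotent is its set of fixed vectors, and taking it is exact. So kernel and
    cokernel are annihilated exactly when [f] is bijective between the images, as the two clauses
    express. *)
Lemma iso_mod_annihP (F G : fun_vect C k) (f : hom F G) :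
  iso_mod annih f <->
  (forall i v, act F (e i) v = v -> nlin (f : nat_trans F G) _ v = 0 -> v = 0) /\
  (forall i w, act G (e i) w = w ->
     exists2 v, act F (e i) v = v & nlin (f : nat_trans F G) _ v = w).
Proof.
split=> [[[N [n [nf N0]]] [Q [p [pf Q0]]]]|[f_inj f_surj]].
  split=> [i v ev fv|i w ew].
    have [u uE] := kernel_exact nf fv.
    by rewrite -ev -uE -nlin_act N0 linear0.
  have [|v vE] := @cokernel_exact _ _ _ _ _ _ _ pf _ w.
    by rewrite -ew nlin_act Q0.
  by exists (act F (e i) v); rewrite ?idem // nlin_act vE.
split.
  exists (sub_functor (ker_sub f)), (sub_incl (ker_sub f)).
  split=> [|i u]; first exact: ker_sub_kernel.
  apply: sub_incl_inj; rewrite linear0 nlin_act.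
  apply: f_inj; first exact: idem.
  by rewrite nlin_act; have /in_ker_sub-> := sub_incl_in u; rewrite linear0.
exists (quot_functor (image_functor f)), (quot_proj (image_functor f)).
split=> [|i q]; first exact: image_cokernel.
have [w <-] := quot_proj_surj q; rewrite -nlin_act.
have [v _ vE] := f_surj _ _ (idem w).
by apply/quot_proj0/in_image; exists v.
Qed.

Variable hs : C -> C -> Type.
Variables (enc : forall x y, hom x y -> hs x y) (dec : forall x y, hs x y -> hom x y).
Hypotheses (encK : forall x y, cancel (@enc x y) (@dec x y))
  (decK : forall x y, cancel (@dec x y) (@enc x y)).

(** * Colocal covers, as quotients of free functors *)

Section ColocalCover.
Variable F : functor C (vect_cat k).

Let X : Type := {i : T & fsp F (y i)}.
Let src (s : X) : C := y (projT1 s).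
Let K := free_functor k encK decK src.
Let gen (s : X) : fsp K (y (projT1 s)) := free_gen k encK decK src s.

Let eps_ex : exists t : nat_trans K F,
  forall s, nlin t _ (gen s) = act F (e (projT1 s)) (projT2 s).
Proof. exact: free_functor_lift. Qed.
Let eps : nat_trans K F := projT1 (cid eps_ex).
Let epsE s : nlin eps _ (gen s) = act F (e (projT1 s)) (projT2 s).
Proof. exact: (projT2 (cid eps_ex)). Qed.

(** Dividing by the first relations makes the generators fixed by the
    idempotents, as in the projective functors [k[hom y -] e]; the second ones
    make [eps] injective on the images of the idempotents. *)
Let rel_gen (U : subfunctor K) : Prop :=
  (forall s : X, gen s - act K (e (projT1 s)) (gen s) \in sub_at U _) /\
  (forall i (n : fsp K (y i)), nlin eps _ n = 0 -> act K (e i) n \in sub_at U _).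

Let rel a : {pred fsp K a} := fun v =>
  `[< forall U : subfunctor K, rel_gen U -> v \in sub_at U a >].

Fact rel_closed a : submod_closed (@rel a).
Proof.
split; first by apply/asboolP => U _; apply: rpred0.
move=> c u v /asboolP uP /asboolP vP; apply/asboolP => U HU.
by rewrite rpredD ?rpredZ ?uP ?vP.
Qed.

Let rel_at a : submodClosed (fsp K a) :=
  HB.pack (@rel a) (GRing.isSubmodClosed.Build k _ (@rel a) (rel_closed a)).

Let rel_sub : subfunctor K.
Proof.
exists rel_at => a b f v /asboolP vP; apply/asboolP => U HU.
exact/sub_stable/vP.
Defined.

Let rel_sub_gen : rel_gen rel_sub.
Proof.
by split=> [s|i n n0]; apply/asboolP => U [HU1 HU2]; [apply: HU1|apply: HU2].
Qed.

Let rel_sub_min (U : subfunctor K) : rel_gen U ->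
  forall a (v : fsp K a), v \in sub_at rel_sub a -> v \in sub_at U a.
Proof. by move=> HU a v /asboolP; apply. Qed.

(** In the quotient [L] of [K], each generator is fixed by its idempotent. Its image under [g] thus
    lifts uniquely through [w] to a fixed vector of [Y], and these lifts define the required
    morphism from [L]. *)
Lemma colocal_cover : exists (L : fun_vect C k) (f : hom L (F : fun_vect C k)),
  iso_mod annih f /\ colocal (@iso_mod _ annih) L.
Proof.
pose L : fun_vect C k := quot_functor rel_sub.
pose p : nat_trans K L := quot_proj rel_sub.
have [f fE] : exists f : nat_trans L F, forall a v, nlin f a (nlin p a v) = nlin eps a v.
  apply: nt_descend => [a v|a v /quot_proj0 vR]; first exact: quot_proj_surj.
  apply/in_ker_sub; apply: rel_sub_min vR.
  split=> [s|i n n0]; apply/in_ker_sub; last by rewrite nlin_act n0 linear0.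
  by rewrite linearB nlin_act epsE idem subrr.
exists L, f; split.
  apply/iso_mod_annihP; split=> [i v|i w ew].
    have [u <-] := quot_proj_surj v => eu; rewrite fE => u0.
    by rewrite -eu -nlin_act; apply/quot_proj0/rel_sub_gen.2.
  (* The fixed vector [w] is reached from the generator that it indexes itself. *)
  pose g : fsp K (y i) := gen (existT _ i w).
  have gE : nlin eps (y i) g = act F (e i) w := epsE (existT _ i w).
  exists (nlin p _ (act K (e i) g)).
    by rewrite -nlin_act idem.
  by rewrite fE nlin_act gE !ew.
have p_gen s : act L (e (projT1 s)) (nlin p _ (gen s)) = nlin p _ (gen s).
  apply/esym/eqP; rewrite -subr_eq0 -nlin_act -linearB; apply/eqP/quot_proj0.
  exact: rel_sub_gen.1.
move=> Y Z w /iso_mod_annihP[w_inj w_surj] g.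
pose g' : nat_trans K Z := nt_comp g p.
have g'E a v : nlin g' a v = nlin (g : nat_trans L Z) a (nlin p a v) by [].
have lift_gen s : exists2 x, act Y (e (projT1 s)) x = x &
    nlin (w : nat_trans Y Z) _ x = nlin g' _ (gen s).
  by apply: w_surj; rewrite g'E -nlin_act p_gen.
pose x s := projT1 (cid2 (lift_gen s)).
have ex s : act Y (e (projT1 s)) (x s) = x s by rewrite /x; case: cid2.
have wx s : nlin (w : nat_trans Y Z) _ (x s) = nlin g' _ (gen s).
  by rewrite /x; case: cid2.
have [h hE] := @free_functor_lift _ _ _ _ _ encK decK _ _ Y x.
have wh : nt_comp w h = g'.
  by apply: (@free_functor_ext _ _ _ _ _ encK decK) => s; rewrite -wx -hE.
have [h' h'E] : exists h' : nat_trans L Y, forall a v, nlin h' a (nlin p a v) = nlin h a v.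
  apply: nt_descend => [a v|a v /quot_proj0 vR]; first exact: quot_proj_surj.
  apply/in_ker_sub; apply: rel_sub_min vR.
  split=> [s|i n n0]; apply/in_ker_sub.
    by rewrite linearB nlin_act [nlin h _ _]hE ex subrr.
  (* Second relations: [e n] vanishes in [L], so [w] kills [h (e n)], and [w] is injective on fixed
     vectors. *)
  apply: (w_inj i); first by rewrite nlin_act idem.
  rewrite -[LHS]/(nlin (nt_comp w h) _ _) wh g'E.
  rewrite [X in nlin g _ X](_ : _ = 0) ?linear0 //.
  exact/quot_proj0/rel_sub_gen.2.
exists h'; split=> [|h2 e2].
  apply: nlinP => a v; have [u <-] := quot_proj_surj v.
  by rewrite -[LHS]/(nlin (w : nat_trans Y Z) a (nlin h' a _)) h'E -g'E -wh.
(* On a generator, both sides are fixed by the idempotent and have the same image under [w]. *)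
have h2E : nt_comp h2 p = h.
  apply: (@free_functor_ext _ _ _ _ _ encK decK) => s; apply/eqP; rewrite -subr_eq0.
  apply/eqP; apply: (w_inj (projT1 s)).
    rewrite linearB; congr (_ - _); last by rewrite [nlin h _ _]hE ex.
    by rewrite -[nlin (nt_comp _ _) _ _]/(nlin h2 _ (nlin p _ _)) -nlin_act p_gen.
  rewrite linearB [nlin h _ _]hE wx g'E -e2; exact: subrr.
apply: nlinP => a v; have [u <-] := quot_proj_surj v.
by rewrite h'E -h2E.
Qed.

End ColocalCover.

(** * Local hulls, as subfunctors of cofree functors *)

Section LocalHull.
Variable F : functor C (vect_cat k).

Let J := cofree_functor encK decK y (fun i => fsp F (y i)).
Let crd a i (p : hom a (y i)) : {linear fsp J a -> fsp F (y i)} :=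
  coord encK decK (fun i => fsp F (y i)) p.

Let crd_flin a b (f : hom a b) i (p : hom b (y i)) u :
  crd p (flin J f u) = crd (p \oc f) u.
Proof. exact: coord_flin. Qed.

Let crdP a (u v : fsp J a) : (forall i (p : hom a (y i)), crd p u = crd p v) -> u = v.
Proof. exact: cofreeP. Qed.

Let crd_act a b i (c : combo k a b) (p : hom b (y i)) (u : fsp J a) :
  crd p (act J c u) = \sum_(t <- c) t.1 *: crd (p \oc t.2) u.
Proof.
by rewrite actE linear_sum; apply: eq_bigr => t _; rewrite linearZ crd_flin.
Qed.

Let eta_ex : exists t : nat_trans F J, forall a i (p : hom a (y i)) v,
  crd p (nlin t a v) = act F (e i) (flin F p v).
Proof. exact: (cofree_functor_lift encK decK (fun i => act F (e i))). Qed.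
Let eta : nat_trans F J := projT1 (cid eta_ex).
Let etaE a i (p : hom a (y i)) v : crd p (nlin eta a v) = act F (e i) (flin F p v).
Proof. exact: (projT2 (cid eta_ex)). Qed.

(** View the coordinates of [u] at [i] as a linear map on [k[hom a (y i)]]. The first condition
    makes it invariant under left multiplication by [e i], hence a map on [e k[hom a (y i)]]. The
    second one makes [eta] surjective onto the images of the idempotents. *)
Let hull a : {pred fsp J a} := fun u => `[<
  (forall i (p : hom a (y i)), \sum_(t <- e i) t.1 *: crd (t.2 \oc p) u = crd p u) /\
  (forall i (p : hom a (y i)), exists v, nlin eta _ v = act J (e i) (flin J p u)) >].

Fact hull_closed a : submod_closed (@hull a).
Proof.
split.
  apply/asboolP; split=> i p; last by exists 0; rewrite !linear0.
  by rewrite (linear0 (crd p)) big1 // => t _; rewrite (linear0 (crd _)) scaler0.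
move=> c u v /asboolP[u1 u2] /asboolP[v1 v2]; apply/asboolP; split=> i p.
  rewrite linearP -u1 -v1 scaler_sumr -big_split; apply: eq_bigr => t _.
  by rewrite linearP scalerDr !scalerA mulrC.
have [u' u'E] := u2 i p; have [v' v'E] := v2 i p.
by exists (c *: u' + v'); rewrite !linearP u'E v'E.
Qed.

Let hull_at a : submodClosed (fsp J a) :=
  HB.pack (@hull a) (GRing.isSubmodClosed.Build k _ (@hull a) (hull_closed a)).

Let hull_sub : subfunctor J.
Proof.
exists hull_at => a b f u /asboolP[u1 u2]; apply/asboolP; split=> i p.
  rewrite crd_flin -[RHS]u1; apply: eq_bigr => t _.
  by rewrite crd_flin -compmA.
by have [v vE] := u2 i (p \oc f); exists v; rewrite vE flinM.
Defined.

Let in_hull a u : u \in sub_at hull_sub a <->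
  (forall i (p : hom a (y i)), \sum_(t <- e i) t.1 *: crd (t.2 \oc p) u = crd p u) /\
  (forall i (p : hom a (y i)), exists v, nlin eta _ v = act J (e i) (flin J p u)).
Proof. by split=> /asboolP. Qed.

(** Elements of the hull can thus be recovered from their images under the idempotents, which is
    what [w] controls in the proof of locality. *)
Let crd_fixed a i (p : hom a (y i)) u : u \in sub_at hull_sub a ->
  crd (idm (y i)) (act J (e i) (flin J p u)) = crd p u.
Proof.
move=> /in_hull[u1 _]; rewrite crd_act -u1; apply: eq_bigr => t _.
by rewrite comp1m crd_flin.
Qed.

(** To extend [g] along [w], send [z] to the unique fixed [x] with [w x = e z], then take the
    coordinate of [g x] at the identity. These functionals [zeta] define a map from [Z] to [J], and
    it lands in the hull. *)
Lemma local_hull : exists (R : fun_vect C k) (f : hom (F : fun_vect C k) R),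
  iso_mod annih f /\ local (@iso_mod _ annih) R.
Proof.
pose R : fun_vect C k := sub_functor hull_sub.
pose j : nat_trans R J := sub_incl hull_sub.
have j_inj a : injective (nlin j a) := @sub_incl_inj _ _ _ hull_sub a.
have j_in a u : nlin j a u \in sub_at hull_sub a := sub_incl_in u.
have [f fE] : exists f : nat_trans F R, forall a v, nlin j a (nlin f a v) = nlin eta a v.
  apply: nt_lift => [|a v]; first exact: sub_incl_inj.
  apply/sub_incl_onto/in_hull; split=> i p.
    under eq_bigr do rewrite etaE flinM -linearZ.
    by rewrite -linear_sum -actE idem etaE.
  by exists (act F (e i) (flin F p v)); rewrite nlin_act nlin_nat.
exists R, f; split.
  apply/iso_mod_annihP; split=> [i v ev fv|i u eu].
    (* The coordinate of [eta v] at the identity is [e v], that is [v]. *)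
    have := etaE (idm (y i)) v; rewrite -fE fv !linear0 flin1 ev => <-.
    by [].
  have /in_hull[_ /(_ i (idm _))[v vE]] := j_in _ u.
  exists (act F (e i) v); first exact: idem.
  apply: j_inj; rewrite fE nlin_act vE flin1 -nlin_act eu.
  by rewrite -nlin_act eu.
move=> Y Z w /iso_mod_annihP[w_inj w_surj] g.
pose g' : nat_trans Y J := nt_comp j g.
have g'E a v : nlin g' a v = nlin j a (nlin (g : nat_trans Y R) a v) by [].
have g'_in a v : nlin g' a v \in sub_at hull_sub a by exact: j_in.
have lift_ex i (z : fsp Z (y i)) : exists2 v, act Y (e i) v = v &
    nlin (w : nat_trans Y Z) _ v = act Z (e i) z.
  by apply: w_surj; rewrite idem.
pose inv i z := projT1 (cid2 (lift_ex i z)).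
have e_inv i z : act Y (e i) (inv i z) = inv i z by rewrite /inv; case: cid2.
have w_inv i z : nlin (w : nat_trans Y Z) _ (inv i z) = act Z (e i) z.
  by rewrite /inv; case: cid2.
have invP i z v : act Y (e i) v = v -> nlin (w : nat_trans Y Z) _ v = act Z (e i) z ->
    inv i z = v.
  move=> ev wv; apply/eqP; rewrite -subr_eq0; apply/eqP/(w_inj i).
    by rewrite linearB e_inv ev.
  by rewrite linearB w_inv wv subrr.
have inv_lin i : linear (inv i).
  move=> c u v; apply: invP; first by rewrite linearP !e_inv.
  by rewrite !linearP !w_inv.
pose zeta i : {linear fsp Z (y i) -> fsp F (y i)} :=
  crd (idm (y i)) \o nlin g' _ \o
  (HB.pack_for {linear fsp Z (y i) -> fsp Y (y i)} (inv i)
     (GRing.isLinear.Build _ _ _ _ _ (inv_lin i))).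
have zetaE i z : zeta i z = crd (idm _) (nlin g' _ (inv i z)) by [].
have zeta_e i z : zeta i (act Z (e i) z) = zeta i z.
  by rewrite !zetaE (@invP i (act Z (e i) z) (inv i z)) // w_inv idem.
have [h hE] := cofree_functor_lift encK decK zeta.
have {}hE a i (p : hom a (y i)) z : crd p (nlin h a z) = zeta i (flin Z p z) by exact: hE.
have hw : nt_comp h w = g'.
  apply: nlinP => a v; apply: crdP => i p.
  rewrite -[RHS]/(crd p _) -[LHS]/(crd p (nlin h a (nlin (w : nat_trans Y Z) a v))).
  rewrite hE zetaE -nlin_nat (@invP _ _ (act Y (e i) (flin Y p v))) ?idem ?nlin_act //.
  by rewrite nlin_nat crd_fixed ?g'_in.
have h_in a z : nlin h a z \in sub_at hull_sub a.
  apply/in_hull; split=> i p.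
    under eq_bigr do rewrite hE flinM -linearZ.
    by rewrite -linear_sum -actE zeta_e hE.
  (* As [w x = e (p z)], applying [e] to the restriction of [h z] along [p] gives [g' x], which is
     in the image of [eta] by the second condition on the hull. *)
  set x := inv i (flin Z p z).
  have /in_hull[_ /(_ i (idm _))[v vE]] := g'_in _ x.
  exists v; rewrite vE flin1 -nlin_act e_inv -nlin_nat -nlin_act -w_inv.
  by rewrite -hw.
have [h' h'E] : exists h' : nat_trans Z R, forall a z, nlin j a (nlin h' a z) = nlin h a z.
  apply: nt_lift => [|a z]; first exact: sub_incl_inj.
  exact/sub_incl_onto/h_in.
exists h'; split=> [|h2 e2].
  apply: nlinP => a v; apply: j_inj.
  rewrite -[LHS]/(nlin j a (nlin h' a (nlin (w : nat_trans Y Z) a v))) h'E -g'E -hw.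
  by [].
(* By [crd_fixed], the coordinate of [h2 z] at [p] depends only on [h2 (e (p z))], where [e (p z)]
   is in the image of [w]. *)
apply: nlinP => a z; apply: j_inj; rewrite h'E; apply: crdP => i p.
rewrite hE zetaE -[RHS]crd_fixed ?j_in // -2!nlin_nat -2!nlin_act -w_inv g'E -e2.
by [].
Qed.

End LocalHull.

Lemma annih_bilocalizing : bilocalizing annih.
Proof.
split; (split; first exact: annih_thick).
- exact: (@reflection_right_adjoint (fun_vect C k) _ local_hull).
- exact: (@coreflection_left_adjoint (fun_vect C k) _ colocal_cover).
Qed.

End IdempotentFamily.
(** * The idempotents defining F_d *)

(** The enumeration serves twice: to average over the groups of morphisms, and to encode morphisms
    by ordinals, which are small whatever the universe of the homs. *)
Lemma k_trivial_enum (k : fieldType) (A : additive_category) (x y : A) :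
  k_trivial k A -> exists n (enc : ahom x y -> 'I_n) (dec : 'I_n -> ahom x y),
    [/\ cancel enc dec, cancel dec enc & (n%:R : k) \is a GRing.unit].
Proof.
move=> /(_ x y)[n /card_set_bijP[f [f_in f_inj f_surj]] nu].
have lt_f u : (f u < n)%N by apply: f_in.
have dec_ex (i : 'I_n) : exists u, f u = i.
  by have [u _ uE] := f_surj i (ltn_ord i); exists u.
exists n, (fun u => Ordinal (lt_f u)), (fun i => projT1 (cid (dec_ex i))); split=> //.
- by move=> u; case: cid => v /= vE; apply: f_inj; rewrite ?inE.
- by move=> i; apply: val_inj; rewrite /=; case: cid.
Qed.

(** * One application of [bar_delta] as the quotient by the kernel of an idempotent *)

Section BarDelta.
Variables (k : fieldType) (A : additive_category).
Hypothesis hk : k_trivial k A.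

Section Idempotent.
Variables (b a : A).

Let card := projT1 (cid (k_trivial_enum b a hk)).
Let enc_ex := projT2 (cid (k_trivial_enum b a hk)).
Let enc : ahom b a -> 'I_card := projT1 (cid enc_ex).
Let dec_ex := projT2 (cid enc_ex).
Let dec : 'I_card -> ahom b a := projT1 (cid dec_ex).
Let encK : cancel enc dec.
Proof. by case: (projT2 (cid dec_ex)). Qed.
Let decK : cancel dec enc.
Proof. by case: (projT2 (cid dec_ex)). Qed.
Let card_unit : (card%:R : k) != 0.
Proof. by case: (projT2 (cid dec_ex)) => _ _; rewrite unitfE. Qed.

Let avg : combo k (b (+) a : A) (b (+) a) :=
  [seq ((card%:R)^-1, shear (dec i)) | i <- enum 'I_card].

Let prin : @hom A (b (+) a) (b (+) a) := acomp (ain2 b a) (apr2 b a).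

(** This is [(1 - prin) avg], where [avg] averages over the shears and [prin] projects [b (+) a]
    onto [a]. *)
Definition delta_idem : combo k (b (+) a : A) (b (+) a) :=
  avg ++ [seq (- t.1, prin \oc t.2) | t <- avg].

Variable G : functor A (vect_cat k).

Let avgE v : act G avg v = (card%:R)^-1 *: \sum_i flin G (shear (dec i)) v.
Proof. by rewrite actE big_map big_enum scaler_sumr. Qed.

Let delta_idemE v : act G delta_idem v = act G avg v - flin G prin (act G avg v).
Proof.
rewrite actE big_cat -actE; congr (_ + _).
rewrite (big_map (fun t => (- t.1, prin \oc t.2))) actE linear_sum -sumrN.
by apply: eq_bigr => t _; rewrite linearZ scaleNr flinM.
Qed.

Let shearD (u u' : ahom b a) : shear u \oc shear u' = shear (u + u') :> hom _ _.
Proof.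
rewrite /= /shear mx22M !acomp0l !acomp0r !acomp1m !acompm1.
by rewrite !addr0 !add0r.
Qed.

Let avg_shear u v : act G avg (flin G (shear u) v) = act G avg v.
Proof.
rewrite !avgE; congr (_ *: _).
have shift_bij : bijective (fun i => enc (dec i + u)).
  exists (fun i => enc (dec i - u)) => i; rewrite encK ?addrK ?subrK decK //.
rewrite [RHS](reindex _ (onW_bij _ shift_bij)); apply: eq_bigr => i _.
by rewrite -flinM shearD encK.
Qed.

Let avg_prin v : act G avg (flin G prin v) = flin G prin v.
Proof.
rewrite avgE; under eq_bigr => i _.
  rewrite -flinM (_ : _ \oc _ = prin); last first.
    by rewrite /= /prin /shear acompA mx22_in2 acomp0r add0r acompm1.
  over.
by rewrite sumr_const card_ord -scaler_nat scalerA mulVf // scale1r.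
Qed.

Let avg_avg v : act G avg (act G avg v) = act G avg v.
Proof.
rewrite [act G avg v in LHS]avgE (linearZZ (act G avg)) (linear_sum (act G avg)).
under eq_bigr do rewrite avg_shear.
by rewrite sumr_const card_ord -scaler_nat scalerA mulVf // scale1r.
Qed.

Let prin_prin v : flin G prin (flin G prin v) = flin G prin v.
Proof.
rewrite -flinM /= /prin; congr (flin G _ v).
by rewrite -acompA [acomp (apr2 b a) _]acompA apr2_in2 acomp1m.
Qed.

(** Shears fix the inclusion of [a], so [avg prin = prin]. As [avg] and [prin] are idempotent,
    [avg (1 - prin) avg = (1 - prin) avg], and another factor [1 - prin] changes nothing. *)
Lemma delta_idem_idem v : act G delta_idem (act G delta_idem v) = act G delta_idem v.
Proof.
rewrite !delta_idemE (linearB (act G avg)) avg_avg avg_prin.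
by rewrite (linearB (flin G prin)) prin_prin subrr subr0.
Qed.

Definition delta_proj : nat_trans (tau b G) (bar_delta b G) :=
  nt_comp (quot_proj (image_functor (incl_bar_tau b G))) (quot_proj (coinv_sub b G)).

Lemma delta_proj_surj q : exists v, nlin delta_proj a v = q.
Proof.
have [w <-] := quot_proj_surj q; have [v <-] := quot_proj_surj w.
by exists v.
Qed.

Let avg_ker : {pred fsp G (b (+) a)} := fun v => act G avg v == 0.

Fact avg_ker_closed : submod_closed avg_ker.
Proof.
split=> [|c u v]; rewrite ![_ \in avg_ker]unfold_in ?linear0 // linearP.
by move=> /eqP-> /eqP->; rewrite scaler0 addr0.
Qed.

Let avg_ker_sub : submodClosed (fsp (tau b G) a) :=
  HB.pack avg_ker (GRing.isSubmodClosed.Build k _ avg_ker avg_ker_closed).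

(** Averaging kills every [u v - v] by translation invariance; conversely, the order of the group
    being invertible, [v - avg v] is a combination of such differences. *)
Let coinvP (v : fsp (tau b G) a) :
  v \in sub_at (coinv_sub b G) a <-> act G avg v = 0.
Proof.
split=> [vS|v0].
  apply/eqP; apply: (lspan_min (S := avg_ker_sub) _ vS) => _ [u [w ->]].
  by apply/eqP; rewrite linearB avg_shear subrr.
suff: v - act G avg v \in sub_at (coinv_sub b G) a by rewrite v0 subr0.
have -> : v - act G avg v =
    - ((card%:R)^-1 *: \sum_i (flin G (shear (dec i)) v - v)).
  rewrite sumrB scalerBr -avgE sumr_const card_ord -scaler_nat scalerA mulVf //.
  by rewrite scale1r opprB.
rewrite rpredN rpredZ // rpred_sum // => i _.
by apply: lspan_gen; exists (dec i), v.
Qed.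

(** The vector [v] dies in [bar_delta] when [v] and some vector coming from [G a] have the same
    average. Vectors coming from [G a] are their own averages and are fixed by [prin], so this says
    that [prin] fixes [avg v]. *)
Lemma delta_proj0 v : nlin delta_proj a v = 0 <-> act G delta_idem v = 0.
Proof.
have in2_prin w : flin G prin (flin G (ain2 b a : @hom A a (b (+) a)) w) =
    flin G (ain2 b a : @hom A a (b (+) a)) w.
  rewrite -flinM /= /prin; congr (flin G _ w).
  by rewrite -acompA apr2_in2 acompm1.
have prinE w : flin G prin w = flin G (ain2 b a : @hom A a (b (+) a))
    (flin G (apr2 b a : @hom A (b (+) a) a) w) by rewrite -flinM.
rewrite delta_idemE; split=> [/quot_proj0/in_image[w wE]|e0].
  have /coinvP : v - flin G (ain2 b a : @hom A a (b (+) a)) w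
      \in sub_at (coinv_sub b G) a by apply/quot_piP; symmetry.
  rewrite -in2_prin linearB avg_prin in2_prin => /eqP; rewrite subr_eq0 => /eqP->.
  by rewrite in2_prin subrr.
(* When [prin] fixes [avg v], this average comes from its own component in [G a]. *)
apply/quot_proj0/in_image; exists (flin G (apr2 b a : @hom A (b (+) a) a) (act G avg v)).
move/eqP: e0; rewrite subr_eq0 => /eqP e0; apply/quot_piP.
suff /coinvP : act G avg (flin G prin (act G avg v) - v) = 0 by rewrite prinE.
by rewrite (linearB (act G avg)) avg_prin -e0 subrr.
Qed.

End Idempotent.
End BarDelta.

(** * Idempotents for the iterated [bar_delta], and the conclusion *)

Section Levels.
Variables (k : fieldType) (A : additive_category).
Hypothesis hk : k_trivial k A.

Let Phi (s : seq A) (x : A) (F : functor A (vect_cat k)) : functor A (vect_cat k) :=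
  foldr (@bar_delta A k) (tau x F) s.

(** [L] and [e] are chosen before [F], so the same idempotents test all functors. Prepending [b] to
    the list replaces [L a] by [L (b (+) a)] and multiplies the previous idempotent by the image
    under [L] of [delta_idem]. *)
Lemma bar_delta_iter_idem (s : seq A) (x : A) :
  exists (L : functor A A) (e : forall a : A, combo k (L a) (L a)),
    (forall a (F : functor A (vect_cat k)) v,
       act F (e a) (act F (e a) v) = act F (e a) v) /\
    forall F : functor A (vect_cat k),
      exists p : nat_trans (comp_functor F L) (Phi s x F),
        (forall a q, exists v, nlin p a v = q) /\
        (forall a (v : fsp F (L a)), nlin p a v = 0 <-> act F (e a) v = 0).
Proof.
elim: s => [|b s [L [e [e_idem pex]]]].
  exists (sum_functor x), (fun a => [:: (1, idm _)]).
  have idE (F : functor A (vect_cat k)) (a : A) (v : fsp F a) :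
      act F [:: (1, idm a)] v = v by rewrite actE big_seq1 scale1r flin1.
  split=> [a F v|F]; first by rewrite !idE.
  exists (nt_id (tau x F)); split=> [a q|a v]; first by exists q.
  by rewrite idE.
exists (comp_functor L (sum_functor b)).
pose lL a : combo k (L (b (+) a)) (L (b (+) a)) :=
  [seq (t.1, fmap L t.2) | t <- delta_idem hk b a].
have lLE (F : functor A (vect_cat k)) a (v : fsp F (L (b (+) a))) :
    act F (lL a) v = act (comp_functor F L) (delta_idem hk b a) v.
  by rewrite !actE big_map.
exists (fun a => [seq (t.1 * u.1, t.2 \oc u.2) | t <- e (b (+) a), u <- lL a]).
split=> [a F v|F].
  rewrite !act_prod; set w := act F (lL a) v.
  have [p [_ p0]] := pex F.
  (* Write [l] for the action of [lL a]. The kernel of [e] is that of the natural map [p], hence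
     stable under [l]. Thus [e l (1 - e) = 0], and [e l e l = e l l = e l]. *)
  have ker_stable u : act F (e (b (+) a)) u = 0 -> act F (e (b (+) a)) (act F (lL a) u) = 0.
    by rewrite -!p0 lLE => pu; rewrite nlin_act pu linear0.
  have := ker_stable (w - act F (e (b (+) a)) w).
  rewrite (linearB (act F _)) e_idem subrr => /(_ erefl).
  rewrite (linearB (act F (lL a))) (linearB (act F _)) => /eqP; rewrite subr_eq0 => /eqP <-.
  by rewrite /w !lLE delta_idem_idem.
have [p [p_surj p0]] := pex F.
pose t a : hom (comp_functor F (comp_functor L (sum_functor b)) a)
    (Phi (b :: s) x F a) :=
  delta_proj b (Phi s x F) a \oc p (b (+) a).
have t_nat a a' (f : hom a a') :
    t a' \oc fmap (comp_functor F (comp_functor L (sum_functor b))) f =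
    fmap (Phi (b :: s) x F) f \oc t a.
  pose d := delta_proj b (Phi s x F).
  have pf := nt_nat p (fmap (sum_functor b) f).
  have df : d a' \oc fmap (Phi s x F) (fmap (sum_functor b) f) =
    fmap (Phi (b :: s) x F) f \oc d a := nt_nat d f.
  apply: etrans (esym (compmA _ _ _)) _; apply: etrans (congr1 (comp (d a')) pf) _.
  by rewrite compmA df -compmA.
exists (NatTrans t_nat); split=> [a q|a v].
  have [u <-] := delta_proj_surj q; have [v <-] := p_surj _ u.
  by exists v.
have -> : nlin (NatTrans t_nat) a v =
  nlin (delta_proj b (Phi s x F)) a (nlin p (b (+) a) v) by [].
by rewrite (delta_proj0 hk) act_prod -p0 lLE -nlin_act.
Qed.

End Levels.

(** It remains to exhibit [Fd] as the annihilator of a small family of idempotents, the objects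
    [L a] being replaced by isomorphic representatives [f j]. *)
Theorem proposition8p8 (k : fieldType) (A : additive_category)
    (hA : essentially_small A) (hk : k_trivial k A) (d : int) (hd : -1 <= d) :
  bilocalizing (Fd A k d).
Proof.
have [I [f f_ess]] := hA.
pose hs (x y : A) := 'I_(projT1 (cid (k_trivial_enum x y hk))).
have [enc [dec [encK decK]]] : exists (enc : forall x y : A, hom x y -> hs x y)
    (dec : forall x y : A, hs x y -> hom x y),
    (forall x y, cancel (@enc x y) (@dec x y)) /\ (forall x y, cancel (@dec x y) (@enc x y)).
  pose ex x y := projT2 (cid (k_trivial_enum x y hk)).
  exists (fun x y => projT1 (cid (ex x y))).
  exists (fun x y => projT1 (cid (projT2 (cid (ex x y))))).
  by split=> x y; case: (projT2 (cid (projT2 (cid (ex x y))))).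
pose dcombo (j : I) (c : seq (k * hs (f j) (f j))) : combo k (f j) (f j) :=
  [seq (t.1, dec _ _ t.2) | t <- c].
pose good (j : I) (c : combo k (f j) (f j)) :=
  (forall (F : functor A (vect_cat k)) v, act F c (act F c v) = act F c v) /\
  (forall F : fun_vect A k, Fd A k d F -> forall v : fsp F (f j), act F c v = 0).
(* The family takes all encoded combinations that act idempotently and vanish on [Fd]. Being cut out
   by a proposition, [T] stays small, and one inclusion holds by construction. *)
pose T := {t : {j : I & seq (k * hs (f j) (f j))} |
  good (projT1 t) (dcombo (projT1 t) (projT2 t))}.
pose y (t : T) : A := f (projT1 (sval t)).
pose e (t : T) : combo k (y t) (y t) := dcombo _ (projT2 (sval t)).
have e_idem t (F : functor A (vect_cat k)) v : act F (e t) (act F (e t) v) = act F (e t) v.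
  exact: (proj2_sig t).1.
suff -> : Fd A k d = annih e by exact: (annih_bilocalizing e_idem encK decK).
apply/predeqP => F; split=> [FF t v|F0 s x sz].
  exact: (proj2_sig t).2.
have [L [c [c_idem pex]]] := bar_delta_iter_idem hk s x.
apply/fun_vect_zeroP => a q.
have [p [p_surj p0]] := pex F; have [u <-] := p_surj _ q.
apply/p0.
have [j [phi [psi [psiK phiK]]]] := f_ess (L a).
(* The idempotent at [L a] is transported along the isomorphism with [f j]; the result is [good], so
   it belongs to the family and kills [F]. *)
pose c' : combo k (f j) (f j) := [seq (t.1, phi \oc t.2 \oc psi) | t <- c a].
have c'E G v : act G c' v = flin G phi (act G (c a) (flin G psi v)).
  rewrite !actE big_map (linear_sum (flin G phi)); apply: eq_bigr => t _.
  by rewrite linearZ !flinM.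
have c'_good : good j c'.
  split=> [G v|G GF v].
    by rewrite !c'E -(flinM psi phi) psiK flin1 c_idem.
  have [pG [_ pG0]] := pex G; have /fun_vect_zeroP G0 := GF s x sz.
  by rewrite c'E (_ : act G (c a) _ = 0) ?linear0 //; apply/pG0/G0.
pose c'' : seq (k * hs (f j) (f j)) := [seq (t.1, enc _ _ t.2) | t <- c'].
have c''E : dcombo j c'' = c'.
  rewrite /dcombo -map_comp; apply: map_id_in => -[r h] _ /=.
  by rewrite encK.
have c''_good : good j (dcombo j c'') by rewrite c''E.
have := F0 (exist _ (existT _ j c'') c''_good) (flin F phi u).
rewrite [act _ _ _](_ : _ = act F c' (flin F phi u)); last by rewrite -c''E.
rewrite c'E -(flinM psi phi) psiK flin1 => /(congr1 (flin F psi)).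
by rewrite -flinM psiK flin1 linear0.
Qed.
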